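(* Let $\Delta$ be a positive integer, $\beta>0$, $\gamma\ge 0$ and $\lambda_0\in\mathbb{R}$, and suppose that one of the following four conditions holds: 1. $\beta\gamma>1$ and $0<\lambda_0<\left(\frac{\beta}{\gamma}\right)^{\frac{\sqrt{\beta\gamma}}{\sqrt{\beta\gamma}-1}}\max\{1,\gamma\}^{\frac{2\sqrt{\beta\gamma}}{\sqrt{\beta\gamma}-1}-\Delta}$; 2. $\beta\gamma>1$ and $0>\lambda_0>-\max\{1,\gamma\}^{-\Delta}$; 3. $\sqrt{\beta\gamma}\le\frac{\Delta-2}{\Delta}$, $\lambda_0>0$, and $\lambda_0<\lambda_c(d_c)$ if $\beta>1$ and $\Delta>d_c+1$, while $\lambda_0<\lambda_c(\Delta-1)$ otherwise; 4. $\beta\gamma<1$, $\lambda_0<0$, and $\lambda_0>-\min\left\{1,\frac{\beta-1}{1-\gamma}\right\}$ if $\beta>1$ and $\Delta>\frac{1-\beta\gamma}{(\beta-1)(1-\gamma)}+1$, while $\lambda_0>-\frac{\beta\check{x}_d-1}{(\check{x}_d-\gamma)\check{x}_d^{\,d}}$ with $d=\Delta-1$ otherwise. Then there exists $\delta>0$, depending on $\Delta,\beta,\gamma,\lambda_0$, such that $Z^{\beta,\gamma}_{\tau_S}(G,\lambda)\neq 0$ for every $\lambda\in\mathcal{U}([0,\lambda_0],\delta)$ with $\lambda\neq 0$, every finite graph $G$ of maximum degree at most $\Delta$, and every feasible configuration $\tau_S$ on $G$.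
   Context: 2-spin systems: for a finite graph $G=(V,E)$, $S\subseteq V$, $\tau_S\in\{0,1\}^S$ and $\lambda\in\mathbb{C}$, let $Z^{\beta,\gamma}_{\tau_S}(G,\lambda)=\sum_{\sigma\in\{0,1\}^V,\ \sigma|_S=\tau_S}\prod_{(u,v)\in E}A_{\sigma(u),\sigma(v)}\prod_{v\in V}b_{\sigma(v)}$, where $A_{0,0}=\beta$, $A_{0,1}=A_{1,0}=1$, $A_{1,1}=\gamma$, $b_0=1$, $b_1=\lambda$. A configuration $\tau_S$ is feasible if (when $\beta=0$) there is no edge with both endpoints in $S$ both assigned $0$ by $\tau_S$, and (when $\gamma=0$) there is no edge with both endpoints in $S$ both assigned $1$. For real $\lambda_0$ and $\delta>0$, $\mathcal{U}([0,\lambda_0],\delta)=\{z\in\mathbb{C}:|z-t|<\delta$ for some real $t$ in the closed segment between $0$ and $\lambda_0\}$. For real $d$ with $\sqrt{\beta\gamma}\le\frac{d-1}{d+1}$ define $\hat{x}_d=\frac{-1-\beta\gamma+d(1-\beta\gamma)-\sqrt{(-1-\beta\gamma+d(1-\beta\gamma))^2-4\beta\gamma}}{2\gamma}$ if $\gamma>0$ and $\hat{x}_d=\frac{\beta}{d-1}$ if $\gamma=0$, and $\lambda_c(d)=\hat{x}_d\left(\frac{\hat{x}_d+\beta}{\gamma\hat{x}_d+1}\right)^d$. Let $\bar d=\frac{1+\sqrt{\beta\gamma}}{1-\sqrt{\beta\gamma}}$. When $\beta\gamma<1$ and $\beta>1$, $d_c$ denotes the unique $d>\bar d$ with $\hat{x}_d=x_c$,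 where $x_c$ is the unique zero in $(0,\sqrt{\beta/\gamma})$ (in $(0,\infty)$ if $\gamma=0$) of $\varphi(x)=\frac{2(1-\beta\gamma)x}{\beta-\gamma x^2}+\ln\frac{\gamma x+1}{x+\beta}$; equivalently $\lambda_c$ is strictly decreasing on $(\bar d,d_c)$ and strictly increasing on $(d_c,\infty)$. For $\beta\gamma<1$ and $d>0$, $\check{x}_d=\frac{1-\beta\gamma+d(1+\beta\gamma)+\sqrt{(1-\beta\gamma+d(1+\beta\gamma))^2-4\beta\gamma d^2}}{2\beta d}$.
   Formalization: In condition 4 the ''otherwise'' case is taken only for Δ ≥ 2, since x̌_d is undefined at d = Δ−1 = 0; in condition 3 with γ = 0 and Δ = 2, where x̂_1 = β/0, λ_c(1) is read as +∞. *)

(* Defs.v *)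
From HB Require Import structures.
From mathcomp Require Import all_boot all_order all_algebra complex.
From mathcomp Require Import boolp classical_sets reals ereal exp.
Set Implicit Arguments.
Unset Strict Implicit.
Unset Printing Implicit Defensive.
Import Order.TTheory GRing.Theory Num.Theory.
Local Open Scope ring_scope.
Local Open Scope complex_scope.

Definition simple_graph (V : finType) (e : rel V) : Prop :=
  symmetric e /\ irreflexive e.

Definition max_degree_le (V : finType) (e : rel V) (Delta : nat) : Prop :=
  forall v : V, (#|[set u | e v u]| <= Delta)%N.

(* The spin 0 is false and the spin 1 is true. *)
Definition edge_weight (R : realType) (beta gamma : R) (i j : bool) : R :=
  match i, j with
  | false, false => beta
  | true, true => gamma
  | _, _ => 1
  end.

Definition vertex_weight (R : realType) (lambda : R[i]) (i : bool) : R[i] :=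
  if i then lambda else 1.

(* The pinned set is S; only the values of tau on S matter.  Each undirected
   edge is counted once, as the ordered pair that is increasing for the
   canonical enumeration of V; since edge_weight is symmetric, the choice of
   orientation is irrelevant. *)
Definition partition_function (R : realType) (beta gamma : R) (V : finType)
    (e : rel V) (S : {set V}) (tau : V -> bool) (lambda : R[i]) : R[i] :=
  \sum_(sigma : {ffun V -> bool} | [forall v in S, sigma v == tau v])
    (\prod_(p : V * V | e p.1 p.2 && (enum_rank p.1 < enum_rank p.2)%N)
        (edge_weight beta gamma (sigma p.1) (sigma p.2))%:C) *
    \prod_(v : V) vertex_weight lambda (sigma v).

Definition feasible (R : realType) (beta gamma : R) (V : finType)
    (e : rel V) (S : {set V}) (tau : V -> bool) : Prop :=
  (beta = 0 -> forall u v, u \in S -> v \in S -> e u v ->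
     ~ (tau u = false /\ tau v = false)) /\
  (gamma = 0 -> forall u v, u \in S -> v \in S -> e u v ->
     ~ (tau u = true /\ tau v = true)).

Definition segment_nbhd (R : realType) (lambda0 delta : R) (z : R[i]) : Prop :=
  exists t : R, [/\ Num.min 0 lambda0 <= t, t <= Num.max 0 lambda0
                  & `|z - t%:C| < delta%:C].

Definition x_hat (R : realType) (beta gamma d : R) : R :=
  if gamma == 0 then beta / (d - 1)
  else
    let b := - 1 - beta * gamma + d * (1 - beta * gamma) in
    (b - Num.sqrt (b ^+ 2 - 4 * (beta * gamma))) / (2 * gamma).

(* For gamma = 0 and d = 1 one has x_hat = beta / 0, to be read as +oo, and
   hence lambda_c(1) = +oo; this is the only reason for the codomain \bar R. *)
Definition lambda_c (R : realType) (beta gamma d : R) : \bar R :=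
  if (gamma == 0) && (d == 1) then +oo%E
  else
    let x := x_hat beta gamma d in
    (x * ((x + beta) / (gamma * x + 1)) `^ d)%:E.

Definition d_bar (R : realType) (beta gamma : R) : R :=
  (1 + Num.sqrt (beta * gamma)) / (1 - Num.sqrt (beta * gamma)).

Definition phi (R : realType) (beta gamma x : R) : R :=
  2 * (1 - beta * gamma) * x / (beta - gamma * x ^+ 2)
  + ln ((gamma * x + 1) / (x + beta)).

(* x_c and d_c are meaningful only when beta * gamma < 1 < beta, in which case
   the points below exist and are unique; elsewhere they are junk. *)
Definition x_c (R : realType) (beta gamma : R) : R :=
  xget 0 (fun x : R => [/\ 0 < x,
                           gamma = 0 \/ x < Num.sqrt (beta / gamma)
                         & phi beta gamma x = 0]).

Definition d_c (R : realType) (beta gamma : R) : R :=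
  xget 0 (fun d : R => d_bar beta gamma < d /\
                       x_hat beta gamma d = x_c beta gamma).

Definition x_check (R : realType) (beta gamma d : R) : R :=
  let b := 1 - beta * gamma + d * (1 + beta * gamma) in
  (b + Num.sqrt (b ^+ 2 - 4 * (beta * gamma) * d ^+ 2)) / (2 * beta * d).

Definition condition1 (R : realType) (Delta : nat) (beta gamma lambda0 : R)
    : Prop :=
  let s := Num.sqrt (beta * gamma) in
  [/\ 1 < beta * gamma, 0 < lambda0
    & lambda0 < (beta / gamma) `^ (s / (s - 1)) *
                (Num.max 1 gamma) `^ (2 * s / (s - 1) - Delta%:R)].

Definition condition2 (R : realType) (Delta : nat) (beta gamma lambda0 : R)
    : Prop :=
  [/\ 1 < beta * gamma, lambda0 < 0
    & - (Num.max 1 gamma) ^- Delta < lambda0].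

Definition condition3 (R : realType) (Delta : nat) (beta gamma lambda0 : R)
    : Prop :=
  let bound : \bar R :=
    if (1 < beta) && (d_c beta gamma + 1 < Delta%:R)
    then lambda_c beta gamma (d_c beta gamma)
    else lambda_c beta gamma (Delta%:R - 1) in
  [/\ Num.sqrt (beta * gamma) <= (Delta%:R - 2) / Delta%:R, 0 < lambda0
    & (lambda0%:E < bound)%E].

(* x_check is defined only for d > 0, whence (1 < Delta) in the second branch
   (Delta = 1 can only fall in that branch). *)
Definition condition4 (R : realType) (Delta : nat) (beta gamma lambda0 : R)
    : Prop :=
  let d := Delta.-1 in
  let x := x_check beta gamma d%:R in
  [/\ beta * gamma < 1, lambda0 < 0
    & if (1 < beta) &&
         ((1 - beta * gamma) / ((beta - 1) * (1 - gamma)) + 1 < Delta%:R)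
      then - Num.min 1 ((beta - 1) / (1 - gamma)) < lambda0
      else (1 < Delta)%N &&
           (- ((beta * x - 1) / ((x - gamma) * x ^+ d)) < lambda0)].

(* Main.v *)
Require Import Defs.
From HB Require Import structures.
From mathcomp Require Import all_boot all_order all_algebra complex.
From mathcomp Require Import boolp classical_sets reals ereal topology normedtype.
From mathcomp Require Import sequences derive realfun exp trigo.
From mathcomp Require Import ring lra.
Set Implicit Arguments.
Unset Strict Implicit.
Unset Printing Implicit Defensive.
Import Order.TTheory GRing.Theory Num.Theory.
Import numFieldNormedType.Exports.
Import Normc.
Local Open Scope ring_scope.
Local Open Scope complex_scope.

(* The ratio of a vertex (the weight of spin 1 over the weight of spin 0) obeys
   R_v = lambda * prod_i h(R_i) with h(x) = (1 + gamma x) / (beta + x), where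
   R_i is the ratio of the i-th neighbour in the graph without v, the other
   copies of v being pinned leaves.  Hence there are no zeros as soon as some set H
   contains h(0) = 1 / beta and h(oo) = gamma, is mapped to itself by
   (y_1, ..., y_k) |-> h(lambda y_1 ... y_k) for k < Delta, and -1 is not of the
   form lambda y_1 ... y_k with k <= Delta.

   For lambda0 < 0, H is a disk |y| <= M, with M = max(1, gamma), 1 or x_check.

   For lambda0 > 0, H is the image under w |-> exp(L - w) of a thin sector
   |Im w| <= eps Re w.  Products of elements of H correspond to sums in the
   sector, so the degree disappears, and H is invariant for small eps provided
   E(x) (ln lambda0 + P - ln x) < L - ln h(x) for all x > 0, where
   E = |d ln h / d ln x| and P >= (Delta - 1) L.  This says that
   ln lambda0 + P is below the minimum of k(x) = ln x + (L - ln h(x)) / E(x).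
   - If beta gamma > 1, take L = ln (max(1, gamma)) and P = (Delta - 1) L; the
     minimum is at sqrt(beta / gamma).
   - If beta gamma < 1, then x k'(x) has the sign of phi(x) - L for
     x < sqrt(beta / gamma), with phi the increasing function that defines x_c.
     Choosing L = phi(xh) and P = L / E(xh) puts the minimum at xh, and the
     condition becomes lambda0 < xh h(xh)^(-1/E(xh)), that is
     lambda0 < lambda_c(d) for xh = x_hat(d), since E(x_hat(d)) = 1 / d.  If
     phi(xh) > 0, the degree may be any integer up to d + 1; if
     phi(xh) = 0 (that is, d = d_c), it is arbitrary. *)

(** * Partition functions along a list of vertices *)

Section ListPartition.
Variables (C : fieldType) (V : eqType) (e : rel V) (A : bool -> bool -> C).
Hypothesis e_sym : symmetric e.
Hypothesis A_sym : forall b c, A b c = A c b.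

Implicit Types (w : bool -> V -> C) (s t : seq V).

(** A neighbour of fixed spin [b] is absorbed into the weights of the vertices in [p]. This realises
    the pinned leaves of the recursion by weights that depend on the vertex. *)
Definition pin (p : pred V) (b : bool) w : bool -> V -> C :=
  fun c u => w c u * (if p u then A b c else 1).

(** Conditioning on the first vertex and absorbing its edges turns vertex deletion, the basic move
    of the ratio recursion, into structural recursion on a list. *)
Fixpoint list_partition s w : C :=
  if s is v :: s' then
    w false v * list_partition s' (pin (e v) false w) +
    w true v * list_partition s' (pin (e v) true w)
  else 1.

Lemma eq_list_partition s w w' :
  (forall b, {in s, w b =1 w' b}) -> list_partition s w = list_partition s w'.
Proof.
elim: s w w' => //= v s IH w w' ww'.
rewrite !ww' ?mem_head//; congr (_ * _ + _ * _); apply: IH => b u us;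
  by rewrite /pin ww' ?inE ?us ?orbT.
Qed.

Lemma pinC (p q : pred V) b b' w : pin p b (pin q b' w) = pin q b' (pin p b w).
Proof. by apply/funext => c; apply/funext => u; rewrite /pin mulrAC. Qed.

(** Any vertex can be expanded first. The inner induction on [t] carries [v] to the front by
    exchanging two consecutive vertices, where the symmetry of [e] and [A] enters. *)
Lemma perm_list_partition s t w : perm_eq s t -> list_partition s w = list_partition t w.
Proof.
elim: s t w => [|v s IH] t w st.
  by rewrite perm_sym in st; rewrite (perm_nilP st).
have vt : v \in t by rewrite -(perm_mem st) mem_head.
have {st} : perm_eq s (rem v t).
  by rewrite -(perm_cons v) (perm_trans st)// perm_to_rem.
move=> st /=; rewrite !(IH _ _ st) {IH st s}.
elim: t w vt => //= u t IH w; rewrite inE [u == v]eq_sym.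
have [->//|uv] /= := eqVneq v u => /IH{}IH.
rewrite -!IH /= !(pinC (e u) (e v)).
rewrite /pin (e_sym u v) (A_sym true false).
by case: (e v u); ring.
Qed.


Section Products.
Variable H : C -> Prop.

Definition prods (n : nat) (p : C) : Prop :=
  exists2 l : seq C, (size l <= n)%N /\ (forall y, y \in l -> H y)
                   & p = \prod_(y <- l) y.

Lemma prods1 n : prods n 1.
Proof. by exists [::] => //; rewrite big_nil. Qed.

Lemma prodsM m n p q : prods m p -> prods n q -> prods (m + n) (p * q).
Proof.
move=> [l [lm lH] ->] [l' [ln l'H] ->]; exists (l ++ l'); last by rewrite big_cat.
split; first by rewrite size_cat leq_add.
by move=> y; rewrite mem_cat => /orP[/lH|/l'H].
Qed.

Lemma prods_gen n y : H y -> (0 < n)%N -> prods n y.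
Proof.
move=> Hy n0; exists [:: y]; last by rewrite big_seq1.
by split=> // z; rewrite inE => /eqP ->.
Qed.

Lemma prods_leq m n p : (m <= n)%N -> prods m p -> prods n p.
Proof. by move=> mn [l [lm lH] ->]; exists l => //; split=> //; exact: leq_trans mn. Qed.

End Products.

(** [d] is the maximum degree minus one: [H_step] serves a vertex with one edge set apart, [H_last]
    a vertex with all its edges. *)
Variables (H : C -> Prop) (lam : C) (d : nat).
Hypothesis A00 : A false false != 0.
Hypothesis A01 : A false true = 1.
Hypothesis H0 : H (A false false)^-1.
Hypothesis H1 : H (A true true).
Hypothesis H_step : forall p, prods H d p ->
  A false false + lam * p != 0 /\
  H ((1 + A true true * (lam * p)) / (A false false + lam * p)).
Hypothesis H_last : forall p, prods H d.+1 p -> 1 + lam * p != 0.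

(** [n u] bounds the number of neighbours of [u] already absorbed into its weights; each of them has
    contributed one factor from [H] to the ratio. *)
Definition ratio_in s w (n : V -> nat) := forall u, u \in s ->
  w false u != 0 /\ exists2 p, prods H (n u) p & w true u = w false u * (lam * p).

(** A new neighbour of spin 1 multiplies the ratio by gamma = h(oo), one of spin 0 by 1 / beta =
    h(0). Both lie in [H]. *)
Lemma ratio_in_pin s w n (p : pred V) b : ratio_in s w n ->
  ratio_in s (pin p b w) (fun u => n u + p u)%N.
Proof.
move=> ws u /ws[wu0 [q nq wu]]; rewrite /pin; case: (p u); last first.
  by rewrite !mulr1 addn0; split=> //; exists q.
case: b; rewrite ?(A_sym true false) A01 ?mulr1.
  split=> //; exists (q * A true true); first exact/prodsM/prods_gen.
  by rewrite wu; ring.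
split; first exact: mulf_neq0.
exists (q * (A false false)^-1); first exact/prodsM/prods_gen.
by rewrite wu; field.
Qed.

Lemma ratio_in_sub s t w n : {subset t <= s} -> ratio_in s w n -> ratio_in t w n.
Proof. by move=> ts ws u /ts/ws. Qed.

Definition nonvanishing N := forall s w n, size s = N -> uniq s ->
  ratio_in s w n -> (forall u, u \in s -> (n u + count (e u) s <= d.+1)%N) ->
  list_partition s w != 0.

(** Proved together with [nonvanishing] by induction on the number of vertices. The vertices of [t]
    have an extra neighbour whose spin switches from 0 to 1; the summand [(u \in t)] counts that
    edge in the degree. *)
Definition ratio_prods N := forall s t w n, size s = N -> uniq s -> uniq t ->
  {subset t <= s} -> ratio_in s w n ->
  (forall u, u \in s -> (n u + count (e u) s + (u \in t) <= d.+1)%N) ->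
  exists2 p, prods H (size t) p &
    list_partition s (pin (mem t) true w) = list_partition s (pin (mem t) false w) * p.

Lemma ratio_prods_nbrs N v s w n : ratio_prods N -> size s = N -> uniq s ->
  ratio_in s w n ->
  (forall u, u \in s -> (n u + count (e u) (v :: s) <= d.+1)%N) ->
  exists2 p, prods H (count (e v) s) p &
    list_partition s (pin (e v) true w) = list_partition s (pin (e v) false w) * p.
Proof.
move=> IH sN us ws ns; pose t := [seq u <- s | e v u].
have ts : {subset t <= s} by move=> u; rewrite mem_filter => /andP[].
have pt b : list_partition s (pin (e v) b w) = list_partition s (pin (mem t) b w).
  by apply: eq_list_partition => c u uls; rewrite /pin /= mem_filter uls andbT.
rewrite !pt -size_filter; apply: (IH _ _ _ n) => //; first exact: filter_uniq.
move=> u uls; rewrite mem_filter uls andbT -addnA [(_ + e v u)%N]addnC e_sym.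
exact: ns.
Qed.

(** Expansion at [u] gives two terms, whose quotient is [lam * (q * p)]: [q] comes from absorbed
    neighbours and [p] from those in the rest of the list. The ratio is then h(lam q p). The edge to
    the pinned leaf is set apart, hence the bound [d]. *)
Lemma ratio_step N s u w n : nonvanishing N -> ratio_prods N ->
  size s = N.+1 -> uniq s -> u \in s -> ratio_in s w n ->
  (forall v, v \in s -> (n v + count (e v) s <= d.+1)%N) ->
  (n u + count (e u) s <= d)%N ->
  exists2 y, H y & list_partition s (pin (pred1 u) true w) =
                   list_partition s (pin (pred1 u) false w) * y.
Proof.
move=> IHn IHr sN us uls ws ns nu; pose s' := rem u s.
have ss' : perm_eq s (u :: s') by exact: perm_to_rem.
have us' : uniq (u :: s') by rewrite -(perm_uniq ss').
have s's : {subset s' <= s} by exact: mem_rem.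
have s'N : size s' = N by rewrite size_rem// sN.
have ns' v : v \in s' -> (n v + count (e v) (u :: s') <= d.+1)%N.
  by move=> /s's/ns; rewrite (permP ss').
have ws' := ratio_in_sub s's ws.
have expand b : list_partition s (pin (pred1 u) b w) =
    w false u * A b false * list_partition s' (pin (e u) false w) +
    w true u * A b true * list_partition s' (pin (e u) true w).
  have pu c : pin (pred1 u) b w c u = w c u * A b c by rewrite /pin /= eqxx.
  rewrite (perm_list_partition _ ss') /= !pu.
  congr (_ * _ + _ * _); apply: eq_list_partition => c v vs'; rewrite /pin /=;
    by case: eqP vs' us' => [->/= ->|_ _ _]; rewrite ?mulr1.
have /andP[us'1 us'2] := us'.
have [p ps' pE] := ratio_prods_nbrs IHr s'N us'2 ws' ns'.
have X0 : list_partition s' (pin (e u) false w) != 0.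
  apply: (IHn _ _ (fun v => n v + e u v)%N) => //; first exact: ratio_in_pin.
  by move=> v vs'; rewrite -addnA (e_sym u v); apply: ns'.
have [wu0 [q nq wu]] := ws u uls.
have [] := @H_step (q * p).
  apply: prods_leq (prodsM nq ps'); apply: leq_trans nu.
  by rewrite leq_add2l (permP ss') /= leq_addl.
move=> den0 Hy; eexists; first exact: Hy.
rewrite !expand pE wu (A_sym true false) A01.
by field.
Qed.

(** Telescoping: the extra neighbour is split into one leaf per vertex of [t], and the leaves switch
    spin one at a time. Each switch contributes one factor by [ratio_step], with the other leaves
    absorbed. *)
Lemma ratio_prods_succ N : nonvanishing N -> ratio_prods N -> ratio_prods N.+1.
Proof.
move=> IHn IHr s t; elim: t => [|u t IHt] w n sN us ut ts ws ns.
  exists 1; first exact: prods1.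
  rewrite mulr1; apply: eq_list_partition => b u _.
  by rewrite /pin.
have /andP[ult ut'] := ut.
have uls : u \in s by apply: ts; rewrite mem_head.
have ts' : {subset t <= s} by move=> v vt; apply: ts; rewrite inE vt orbT.
have pinE b : pin (mem (u :: t)) b w = pin (mem t) b (pin (pred1 u) b w).
  apply/funext => c; apply/funext => v; rewrite /pin /= inE.
  by have [->|] := eqVneq v u; rewrite ?(negPf ult) ?mulr1.
have ns' v : v \in s -> (n v + pred1 u v + count (e v) s + (v \in t) <= d.+1)%N.
  move=> vs; apply: leq_trans (ns v vs); rewrite inE -!addnA leq_add2l addnCA leq_add2l.
  by rewrite /=; have [->|//] := eqVneq v u; rewrite (negPf ult).
have [p tp E1] := IHt _ _ sN us ut' ts' (ratio_in_pin (pred1 u) true ws) ns'.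
have [||y Hy E2] := @ratio_step N s u (pin (mem t) false w) (fun v => n v + (v \in t))%N
   IHn IHr sN us uls (ratio_in_pin (mem t) false ws).
- move=> v vs; apply: leq_trans (ns v vs); rewrite addnAC leq_add2l inE.
  by case: (v \in t); rewrite ?orbT.
- by have := ns u uls; rewrite mem_head addn1 (negPf ult) addn0.
exists (y * p); first by apply: (@prodsM _ 1 (size t)) => //; exact: prods_gen.
by rewrite !pinE E1 pinC E2 pinC mulrA.
Qed.

(** Expansion at the first vertex factors the sum as a nonzero weight, times the partition function
    of the remaining vertices, times 1 + lam q p. *)
Lemma nonvanishing_all N : nonvanishing N.
Proof.
suff: nonvanishing N /\ ratio_prods N by case.
elim: N => [|N [IHn IHr]].
  split=> [[]//= w n _ _ _ _|[]//= [|u t] w n _ _ _ ts _ _]; first exact: oner_neq0.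
    by exists 1; [exact: prods1|rewrite mulr1].
  by have := ts u (mem_head _ _).
split; last exact: ratio_prods_succ.
move=> [|v s]//= w n [sN] /andP[vs us] ws ns.
have ws' : ratio_in s w n.
  by apply: ratio_in_sub ws => u; rewrite inE orbC => ->.
have ns' u : u \in s -> (n u + count (e u) (v :: s) <= d.+1)%N.
  by move=> us'; apply: ns; rewrite inE us' orbT.
have [p ps pE] := ratio_prods_nbrs IHr sN us ws' ns'.
have [wv0 [q nq wv]] := ws v (mem_head _ _).
have X0 : list_partition s (pin (e v) false w) != 0.
  apply: (IHn _ _ (fun u => n u + e v u)%N) => //; first exact: ratio_in_pin.
  by move=> u us'; rewrite -addnA e_sym; apply: ns'.
have := @H_last (q * p); rewrite wv pE => nz.
have -> : forall x y z t : C, x * y + x * z * (y * t) = x * y * (1 + z * t).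
  by move=> *; ring.
rewrite -[lam * q * p]mulrA !mulf_neq0// nz//.
apply: prods_leq (prodsM nq ps); apply: leq_trans (ns v (mem_head _ _)).
by rewrite leq_add2l /= leq_addl.
Qed.

(** A pinned vertex leaves a single term of the expansion. Absorbing it multiplies the surviving
    weights of the other pinned vertices by nonzero factors, which is where feasibility is used. *)
Lemma nonvanishing_pinned (s t : seq V) (tau : V -> bool) w (n : V -> nat) :
  uniq t ->
  (forall u, u \in s -> w (tau u) u != 0 /\ w (~~ tau u) u = 0) ->
  (forall u v, u \in s -> v \in s -> e u v -> A (tau u) (tau v) != 0) ->
  ratio_in t w n ->
  (forall u, u \in t -> (n u + count (e u) (s ++ t) <= d.+1)%N) ->
  list_partition (s ++ t) w != 0.
Proof.
move=> ut; elim: s w n => [|v s IH] w n ws As wt nt; first exact: nonvanishing_all nt.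
have [wv wv0] := ws v (mem_head _ _).
have -> : list_partition ((v :: s) ++ t) w =
    w (tau v) v * list_partition (s ++ t) (pin (e v) (tau v) w).
  by move: wv0 => /=; case: (tau v) => /= ->; rewrite mul0r ?addr0 ?add0r.
apply: mulf_neq0 => //; apply: (IH _ (fun u => n u + e v u)%N).
- move=> u us; have us' : u \in v :: s by rewrite inE us orbT.
  have [wu wu0] := ws u us'; rewrite /pin wu0 mul0r; split=> //.
  apply: mulf_neq0 => //; have [evu|_] := boolP (e v u); last exact: oner_neq0.
  by apply: As => //; rewrite mem_head.
- by move=> u u' us us'; apply: As; rewrite inE ?us ?us' orbT.
- exact: ratio_in_pin.
- by move=> u /nt; rewrite -addnA e_sym.
Qed.

End ListPartition.

(** * Configurations on a graph *)

Section SumOverConfigurations.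
Variables (C : fieldType) (V : finType) (e : rel V) (A : bool -> bool -> C).
Implicit Types (s : seq V) (sigma : {ffun V -> bool}) (w : bool -> V -> C).

Fixpoint list_weight s w sigma : C :=
  if s is v :: s' then
    w (sigma v) v * (\prod_(u <- s') if e v u then A (sigma v) (sigma u) else 1) *
      list_weight s' w sigma
  else 1.

Lemma list_weight_pin s w sigma (p : pred V) b :
  list_weight s (pin A p b w) sigma =
  (\prod_(u <- s) if p u then A b (sigma u) else 1) * list_weight s w sigma.
Proof.
elim: s => [|v s IH] /=; first by rewrite big_nil mulr1.
by rewrite big_cons IH /pin; ring.
Qed.

Lemma eq_list_weight s w sigma sigma' : {in s, sigma =1 sigma'} ->
  list_weight s w sigma = list_weight s w sigma'.
Proof.
elim: s => //= v s IH ss'; rewrite ss' ?mem_head// IH.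
  congr (_ * _ * _); apply: eq_big_seq => u us.
  by rewrite ss' // inE us orbT.
by move=> u us; apply: ss'; rewrite inE us orbT.
Qed.

(** Configurations on a sublist are encoded as configurations on all of [V] that are 0 elsewhere, so
    that every sum ranges over the same type. *)
Definition supp_in s sigma : bool :=
  [forall u, (u \notin s) ==> ~~ sigma u].

Definition upd sigma v b : {ffun V -> bool} :=
  [ffun u => if u == v then b else sigma u].

Lemma sum_supp_cons (F : {ffun V -> bool} -> C) v s : v \notin s ->
  \sum_(sigma | supp_in (v :: s) sigma) F sigma =
  \sum_(sigma | supp_in s sigma) F sigma +
  \sum_(sigma | supp_in s sigma) F (upd sigma v true).
Proof.
move=> vs; rewrite (bigID (fun sigma => ~~ sigma v)) /=; congr (_ + _).
  apply: eq_bigl => sigma; apply/andP/forallP => [[/forallP h sv] u|h].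
    have := h u; rewrite inE; have [->|//] := eqVneq u v.
    by rewrite sv !implybT.
  split; last by have := h v; rewrite vs.
  apply/forallP => u; rewrite inE negb_or; have [//|/= _] := eqVneq u v.
  exact: h.
rewrite (reindex_onto (fun sigma => upd sigma v true) (fun sigma => upd sigma v false)).
  apply: eq_bigl => sigma; rewrite ffunE eqxx andbT; apply/andP/forallP.
    move=> [/forallP h /eqP su] u.
    have sv : sigma v = false by rewrite -su ffunE eqxx.
    have := h u; rewrite inE ffunE.
    have [->|//] := eqVneq u v.
    by rewrite sv implybT.
  move=> h; split.
    apply/forallP => u; rewrite inE ffunE negb_or; have [//|/= _] := eqVneq u v.
    exact: h.
  apply/eqP/ffunP => u; rewrite !ffunE; have [->|//] := eqVneq u v.
  by have := h v; rewrite vs /= => /negbTE.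
move=> sigma /andP[_]; rewrite negbK => sv; apply/ffunP => u; rewrite !ffunE.
by have [->|] := eqVneq u v.
Qed.

Lemma list_partition_sum s w : uniq s ->
  list_partition e A s w = \sum_(sigma | supp_in s sigma) list_weight s w sigma.
Proof.
elim: s w => [|v s IH] w.
  move=> _ /=; rewrite (big_pred1 [ffun=> false]) // => sigma.
  apply/forallP/eqP => [h|-> u]; last by rewrite ffunE.
  by apply/ffunP => u; rewrite ffunE; apply/negbTE; have := h u.
move=> /andP[vs us]; rewrite sum_supp_cons //= !IH // !big_distrr /=.
congr (_ + _); apply: eq_bigr => sigma ssigma; rewrite list_weight_pin.
  have /forallP/(_ v) := ssigma; rewrite vs /= => /negbTE ->.
  by rewrite mulrA.
rewrite mulrA ffunE eqxx; congr (_ * _ * _).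
  apply: eq_big_seq => u us'; rewrite ffunE; case: eqP => // uv.
  by rewrite uv (negPf vs) in us'.
apply: eq_list_weight => u us'; rewrite ffunE; case: eqP => // uv.
by rewrite uv (negPf vs) in us'.
Qed.

(** The recursion charges each edge to the endpoint that comes first in the list, hence the
    comparison of indices. *)
Lemma list_weight_prod s w sigma : uniq s ->
  list_weight s w sigma =
  (\prod_(u <- s) \prod_(v <- s | e u v && (index u s < index v s)%N)
     A (sigma u) (sigma v)) * \prod_(u <- s) w (sigma u) u.
Proof.
elim: s => [|v s IH]; first by rewrite !big_nil mulr1.
move=> /andP[vs us] /=; rewrite IH // !big_cons eqxx andbF.
have -> : \prod_(u <- s | e v u && (0 < (if v == u then 0 else (index u s).+1))%N)
    A (sigma v) (sigma u) = \prod_(u <- s) if e v u then A (sigma v) (sigma u) else 1.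
  rewrite big_mkcond /=; apply: eq_big_seq => u us'.
  by have [uv|] := eqVneq v u; [rewrite uv us' in vs|rewrite andbT].
have -> : \prod_(u <- s) \prod_(v0 <- v :: s | e u v0 &&
      ((if v == u then 0 else (index u s).+1) < (if v == v0 then 0 else (index v0 s).+1))%N)
      A (sigma u) (sigma v0) =
    \prod_(u <- s) \prod_(v0 <- s | e u v0 && (index u s < index v0 s)%N)
      A (sigma u) (sigma v0).
  apply: eq_big_seq => u us'; rewrite big_cons eqxx /= andbF.
  rewrite big_mkcond [RHS]big_mkcond /=; apply: eq_big_seq => u' us''.
  have [uv|_] := eqVneq v u; first by rewrite uv us' in vs.
  by have [uv|_] := eqVneq v u'; [rewrite uv us'' in vs|rewrite ltnS].
ring.
Qed.

End SumOverConfigurations.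

(** * Zero-freeness criterion for the partition function of a graph *)

Section PartitionFunction.
Variables (R : realType) (beta gamma : R) (V : finType) (e : rel V).
Local Notation A := (fun b c => (edge_weight beta gamma b c)%:C).

Lemma index_enum_rank (v : V) : index v (enum V) = enum_rank v.
Proof.
rewrite -{1}(enum_rankK v) (enum_val_nth v) index_uniq ?enum_uniq //.
by rewrite -cardE.
Qed.

(** Pinning is expressed by giving weight 0 to the wrong spin; the orientation of edges by
    [enum_rank] is the order of positions in [enum V]. *)
Lemma partition_functionE (S : {set V}) (tau : V -> bool) (lambda : R[i]) :
  partition_function beta gamma e S tau lambda =
  list_partition e A (enum V)
    (fun b v => if (v \in S) && (b != tau v) then 0 else vertex_weight lambda b).
Proof.
rewrite list_partition_sum ?enum_uniq // /partition_function big_mkcond [RHS]big_mkcond.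
apply: eq_bigr => sigma _.
have -> : supp_in (enum V) sigma by apply/forallP => u; rewrite mem_enum.
rewrite list_weight_prod ?enum_uniq // big_enum /=.
have [/forallP h|/forallPn[v]] := boolP [forall v in S, sigma v == tau v].
  congr (_ * _); last first.
    rewrite big_enum /=; apply: eq_bigr => v _.
    by have := h v; case: (v \in S) => //= /eqP ->; rewrite eqxx.
  rewrite -(pair_big_dep xpredT (fun u v => e u v && (enum_rank u < enum_rank v)%N)
    (fun u v => (edge_weight beta gamma (sigma u) (sigma v))%:C)) /=.
  apply: eq_bigr => u _; rewrite big_enum_cond /=; apply: eq_bigl => v.
  by rewrite !index_enum_rank.
rewrite negb_imply => /andP[vS sv].
by rewrite big_enum /= [X in _ * X](bigD1 v) //= vS sv mul0r mulr0.
Qed.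

Lemma partition_function_neq0 (d : nat) (H : R[i] -> Prop) (lambda : R[i])
    (S : {set V}) (tau : V -> bool) :
  beta != 0 -> simple_graph e -> max_degree_le e d.+1 ->
  feasible beta gamma e S tau -> lambda != 0 ->
  H (beta%:C)^-1 -> H gamma%:C ->
  (forall p, prods H d p -> beta%:C + lambda * p != 0 /\
     H ((1 + gamma%:C * (lambda * p)) / (beta%:C + lambda * p))) ->
  (forall p, prods H d.+1 p -> 1 + lambda * p != 0) ->
  partition_function beta gamma e S tau lambda != 0.
Proof.
move=> b0 [e_sym _] deg [_ feas1] l0 Hb Hg Hstep Hlast.
have A_sym (b c : bool) : (edge_weight beta gamma b c)%:C = (edge_weight beta gamma c b)%:C.
  by case: b; case: c.
rewrite partition_functionE; set w := (X in list_partition _ _ _ X).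
(* The pinned vertices come first; the free ones start from the ratio [lambda], the case of an empty
   product. *)
set s := [seq v <- enum V | v \in S]; set t := [seq v <- enum V | v \notin S].
have st : perm_eq (enum V) (s ++ t) by rewrite perm_sym; apply/permPl/perm_filterC.
rewrite (perm_list_partition e_sym A_sym _ st).
apply: (@nonvanishing_pinned _ _ _ A e_sym A_sym H lambda d _ _ _ _ _ _ s t tau w (fun=> 0%N)) => //.
- by rewrite /= eq_complex /= negb_and b0.
- by rewrite filter_uniq ?enum_uniq.
- move=> u; rewrite mem_filter => /andP[uS _]; rewrite /w uS eqxx /=; split.
    by case: (tau u) => //=; exact: oner_neq0.
  by case: (tau u).
- move=> u v; rewrite !mem_filter => /andP[uS _] /andP[vS _] euv.
  case tu: (tau u); case tv: (tau v) => /=; rewrite ?oner_neq0//.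
    apply/eqP => -[] g0; exact: (feas1 g0 u v).
  by rewrite eq_complex /= negb_and b0.
- move=> u; rewrite mem_filter => /andP[uS _]; rewrite /w (negPf uS) /=; split.
    exact: oner_neq0.
  by exists 1; [exact: prods1|rewrite mul1r mulr1].
- move=> u _; rewrite add0n -(permP st); apply: leq_trans (deg u).
  rewrite cardsE cardE enumT /enum_mem size_filter.
  by apply: sub_count => v.
Qed.

End PartitionFunction.

(** * Invariant disks *)

Local Notation Re := complex.Re.
Local Notation Im := complex.Im.

Section Disk.
Variable R : realType.
Implicit Types (beta gamma M r : R) (z y lambda : R[i]).

Definition zero_free (Delta : nat) beta gamma lambda : Prop :=
  forall (V : finType) (e : rel V), simple_graph e -> max_degree_le e Delta ->
  forall (S : {set V}) (tau : V -> bool), feasible beta gamma e S tau ->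
    partition_function beta gamma e S tau lambda != 0.

Lemma normc_ge0 z : 0 <= normc z.
Proof. by case: z => a b /=; rewrite sqrtr_ge0. Qed.

Lemma sqr_normc_Re_Im z : normc z ^+ 2 = Re z ^+ 2 + Im z ^+ 2.
Proof. by case: z => a b /=; rewrite sqr_sqrtr// addr_ge0 ?sqr_ge0. Qed.

Lemma normcR (a : R) : normc a%:C = `|a|.
Proof. by rewrite /= expr0n /= addr0 sqrtr_sqr. Qed.

Lemma normc_complex z : `|z| = (normc z)%:C.
Proof. by case: z. Qed.

Lemma prods_normc_le M n (p : R[i]) : 1 <= M ->
  prods (fun y => normc y <= M) n p -> normc p <= M ^+ n.
Proof.
move=> M1 [l [ln lM] ->]; apply: le_trans (_ : M ^+ size l <= _); last first.
  exact: ler_weXn2l.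
elim: l {ln} lM => [|y l IH] lM; first by rewrite big_nil normc1 expr0.
rewrite big_cons normcM /= exprS ler_pM ?normc_ge0 ?lM ?mem_head// IH// => z zl.
by apply: lM; rewrite inE zl orbT.
Qed.

(* The image of the disk of radius r under the Moebius map is a disk symmetric
   about the real axis, so its norm is largest at -r or r. *)
Lemma moebius_disk beta gamma M r z : 0 < beta -> 0 <= gamma -> 1 <= M ->
  gamma <= M -> 1 <= M * beta -> r < beta -> gamma * r <= 1 ->
  (M - gamma) * r <= M * beta - 1 -> normc z <= r ->
  beta%:C + z != 0 /\ normc ((1 + gamma%:C * z) / (beta%:C + z)) <= M.
Proof.
move=> b0 g0 M1 gM Mb rb gr Mr zr.
have z0 := normc_ge0 z.
have den : beta%:C + z != 0.
  apply/eqP => bz; suff : normc z = beta by lra.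
  rewrite -[z](addKr beta%:C) bz addr0 normcN normcR gtr0_norm//.
split=> //; rewrite normcM normcV ler_pdivrMr; last first.
  by rewrite lt_def normc_ge0 andbT; apply: contra den => /eqP/eq0_normc ->.
rewrite -(@ler_pXn2r _ 2)// ?nnegrE ?mulr_ge0 ?normc_ge0//; last lra.
rewrite exprMn !sqr_normc_Re_Im.
have zE := sqr_normc_Re_Im z; set rho := normc z in z0 zr zE.
case: z {den} @rho zE z0 zr => [X Y] rho /= zE z0 zr.
have Xr : - rho <= X by nra.
(* For fixed [rho] both squared moduli are affine in [X]. Their difference grows with [X] by [h4],
   and [h3] says that it is nonnegative at X = - rho. *)
have h1 : 0 <= M * (beta - rho) - (1 - gamma * rho) by nra.
have h2 : 0 <= M * (beta - rho) + (1 - gamma * rho) by nra.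
have h3 := mulr_ge0 h1 h2.
have h4 : 0 <= M ^+ 2 * beta - gamma by nra.
have h5 : 0 <= (M ^+ 2 * beta - gamma) * (X + rho) by apply: mulr_ge0 => //; lra.
nra.
Qed.

Lemma zero_free_disk d beta gamma M r lambda : 0 < beta -> 0 <= gamma ->
  1 <= M -> gamma <= M -> 1 <= M * beta -> r < beta -> gamma * r <= 1 ->
  (M - gamma) * r <= M * beta - 1 -> normc lambda * M ^+ d <= r ->
  normc lambda * M ^+ d.+1 < 1 -> lambda != 0 ->
  zero_free d.+1 beta gamma lambda.
Proof.
move=> b0 g0 M1 gM Mb rb gr Mr lr l1 l0 V e eG deg S tau feas.
have Mn (n : nat) p : prods (fun y => normc y <= M) n p ->
    normc (lambda * p) <= normc lambda * M ^+ n.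
  by move=> /(prods_normc_le M1) pM; rewrite normcM ler_wpM2l ?normc_ge0.
apply: (@partition_function_neq0 _ _ _ _ _ d (fun y => normc y <= M)) => //.
- exact: lt0r_neq0.
- by rewrite normcV normcR gtr0_norm// -div1r ler_pdivrMr.
- by rewrite normcR ger0_norm.
- move=> p /Mn pM; apply: (@moebius_disk _ _ _ r) => //; exact: le_trans lr.
- move=> p /Mn pM; apply/eqP => lp.
  have : normc (lambda * p) = 1 by rewrite -[X in normc X](addKr 1) lp addr0 normcN normc1.
  lra.
Qed.

End Disk.

(** * Negative fields *)

Section NegativeFields.
Variable R : realType.
Implicit Types (beta gamma lambda M : R).

Definition zero_free_near (Delta : nat) beta gamma lambda0 : Prop :=
  exists delta : R, 0 < delta /\
    forall lambda : R[i], segment_nbhd lambda0 delta lambda -> lambda != 0 ->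
    zero_free Delta beta gamma lambda.

Lemma segment_nbhd_normc lambda0 delta (lambda : R[i]) :
  segment_nbhd lambda0 delta lambda -> normc lambda < `|lambda0| + delta.
Proof.
move=> [t [t1 t2]]; rewrite normc_complex ltcR => lt.
have tl : `|t| <= `|lambda0|.
  move: t1 t2; rewrite ge_min le_max ler_norml.
  by have [l0|l0] := leP 0 lambda0; [rewrite (ger0_norm l0)|rewrite (ltr0_norm l0)];
    move=> /orP[] h1 /orP[] h2; apply/andP; split; lra.
have := le_normcD (lambda - t%:C) t%:C; rewrite subrK normcR => h.
by apply: le_lt_trans h _; rewrite addrC; apply: ler_ltD.
Qed.

(** The disk conditions involve only the modulus of the field, so they hold in the whole disk of
    radius [rho] about 0, which contains the neighbourhood of the segment. *)
Lemma zero_free_near_disk d beta gamma M lambda0 rho : `|lambda0| < rho ->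
  0 < beta -> 0 <= gamma ->
  1 <= M -> gamma <= M -> 1 <= M * beta ->
  rho * M ^+ d <= beta -> gamma * (rho * M ^+ d) <= 1 ->
  (M - gamma) * (rho * M ^+ d) <= M * beta - 1 -> rho * M ^+ d.+1 <= 1 ->
  zero_free_near d.+1 beta gamma lambda0.
Proof.
move=> lr b0 g0 M1 gM Mb rb gr Mr r1; exists (rho - `|lambda0|).
split; first by rewrite subr_gt0.
move=> lambda /segment_nbhd_normc; rewrite addrC subrK => lrho l0.
have Mn0 (n : nat) : 0 < M ^+ n by apply: exprn_gt0; lra.
have h (n : nat) : normc lambda * M ^+ n < rho * M ^+ n by rewrite ltr_pM2r.
have n0 : 0 <= normc lambda * M ^+ d by rewrite mulr_ge0 ?normc_ge0// ltW.
apply: (@zero_free_disk _ d _ _ M (normc lambda * M ^+ d)) => //.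
- exact: lt_le_trans (h d) _.
- by have := h d; nra.
- by have := h d; nra.
- exact: lt_le_trans (h d.+1) _.
Qed.

(** With M = max(1, gamma), the radius M^(-Delta) for the field is the largest for which the value
    -1 is excluded; it gives rho M^d = 1 / M. *)
Lemma zero_free_near_condition2 Delta beta gamma lambda0 : (0 < Delta)%N ->
  0 < beta -> 0 <= gamma -> condition2 Delta beta gamma lambda0 ->
  zero_free_near Delta beta gamma lambda0.
Proof.
case: Delta => // d _ b0 g0 [bg l0 lM].
set M := Num.max 1 gamma in lM.
have M1 : 1 <= M by rewrite le_max lexx.
have gM : gamma <= M by rewrite le_max lexx orbT.
have Mn0 (n : nat) : 0 < M ^+ n by apply: exprn_gt0; lra.
have E : M ^- d.+1 * M ^+ d = M^-1.
  by rewrite exprS invfM -mulrA mulVf ?mulr1// lt0r_neq0.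
have E' : M ^- d.+1 * M ^+ d.+1 = 1 by rewrite mulVf// lt0r_neq0.
have b1 : gamma < 1 -> 1 < beta by nra.
have [Mg|M1'] : M = gamma /\ 1 <= gamma \/ M = 1 /\ gamma < 1.
  by rewrite /M; case: (leP 1 gamma) => h; [left|right].
- have iM : gamma * gamma^-1 = 1 by rewrite divff//; lra.
  have iM0 : 0 < gamma^-1 by rewrite invr_gt0; lra.
  case: Mg => Mg g1.
  apply: (@zero_free_near_disk d beta gamma M lambda0 (M ^- d.+1)) => //;
    rewrite ?E ?E' ?ltr0_norm//; rewrite ?Mg in lM *; first [lra|nra].
- case: M1' => M1' g1.
  apply: (@zero_free_near_disk d beta gamma M lambda0 (M ^- d.+1)) => //;
    rewrite ?E ?E' ?ltr0_norm//; have := b1 g1; rewrite ?M1' ?invr1 in lM *; first [lra|nra].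
Qed.

(** [x_check] is the larger root of d (beta x - 1)(x - gamma) = (1 - beta gamma) x, the equation for
    a stationary point of (beta x - 1) / ((x - gamma) x^d). At 1 / beta and, if gamma > 0, at gamma
    the left side is the smaller one, so the root lies beyond both. *)
Lemma x_checkP beta gamma (d : R) : 0 < beta -> 0 <= gamma -> beta * gamma < 1 ->
  0 < d -> let x := x_check beta gamma d in
  [/\ d * (beta * x ^+ 2 - (1 + beta * gamma) * x + gamma) = x * (1 - beta * gamma),
      1 < beta * x, gamma < x &
      forall y, d * (beta * y ^+ 2 - (1 + beta * gamma) * y + gamma) <= y * (1 - beta * gamma) ->
        y <= x].
Proof.
move=> b0 g0 bg d0 x.
pose b := 1 - beta * gamma + d * (1 + beta * gamma).
pose D := b ^+ 2 - 4 * (beta * gamma) * d ^+ 2.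
(* Completing the square: the quadratic is nonpositive at [y] only if |2 beta d y - b| is at most
   the square root of the discriminant [D]. *)
have Dy y : D = (2 * beta * d * y - b) ^+ 2 - 4 * beta * d *
    (d * (beta * y ^+ 2 - (1 + beta * gamma) * y + gamma) - y * (1 - beta * gamma)).
  by rewrite /D /b; ring.
have bd : 0 < beta * d by apply: mulr_gt0.
have big y : d * (beta * y ^+ 2 - (1 + beta * gamma) * y + gamma) <= y * (1 - beta * gamma) ->
    y <= x.
  move=> hy; rewrite /x /x_check -/b -/D ler_pdivlMr; last lra.
  have : `|2 * beta * d * y - b| <= Num.sqrt D.
    rewrite -sqrtr_sqr ler_wsqrtr// (Dy y); nra.
  by rewrite ler_norml => /andP[_]; lra.
have bbx : d * (beta * (beta^-1) ^+ 2 - (1 + beta * gamma) * beta^-1 + gamma) <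
    beta^-1 * (1 - beta * gamma).
  have -> : d * (beta * (beta^-1) ^+ 2 - (1 + beta * gamma) * beta^-1 + gamma) = 0.
    by field; exact: lt0r_neq0.
  by apply: mulr_gt0; rewrite ?invr_gt0//; lra.
have D0 : 0 < D.
  have bd' : 0 < 4 * beta * d by lra.
  rewrite (Dy beta^-1); apply: ltr_wpDl; first exact: sqr_ge0.
  by rewrite -mulrN mulr_gt0//; lra.
have xE : 2 * beta * d * x - b = Num.sqrt D.
  by rewrite /x /x_check -/b -/D; field; rewrite !lt0r_neq0.
have eqx : d * (beta * x ^+ 2 - (1 + beta * gamma) * x + gamma) = x * (1 - beta * gamma).
  have := Dy x; rewrite xE sqr_sqrtr ?ltW// => h.
  have bd4 : 0 < 4 * beta * d by lra.
  by apply/eqP; rewrite -subr_eq0 -(mulrI_eq0 _ (lregP (lt0r_neq0 bd4))); apply/eqP; lra.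
have x1 : beta^-1 < x.
  by rewrite lt_neqAle big ?andbT ?ltW//; apply: contraTneq bbx => ->; rewrite eqx ltxx.
have bx : 1 < beta * x by rewrite mulrC -ltr_pdivrMr// div1r.
split=> //; have [->|gn0] := eqVneq gamma 0; first nra.
have gg : 0 < gamma by rewrite lt_def gn0.
have bbg : d * (beta * gamma ^+ 2 - (1 + beta * gamma) * gamma + gamma) <
    gamma * (1 - beta * gamma).
  have -> : d * (beta * gamma ^+ 2 - (1 + beta * gamma) * gamma + gamma) = 0 by ring.
  by apply: mulr_gt0 => //; lra.
rewrite lt_neqAle big ?andbT ?ltW//; apply/eqP => gx.
by move: bbg eqx; rewrite -gx; lra.
Qed.

Lemma zero_free_near_condition4 Delta beta gamma lambda0 : (0 < Delta)%N ->
  0 < beta -> 0 <= gamma -> condition4 Delta beta gamma lambda0 ->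
  zero_free_near Delta beta gamma lambda0.
Proof.
case: Delta => // d _ b0 g0 [bg l0] /=.
case: ifPn => [/andP[b1 _]|nb].
  have g1 : gamma < 1 by nra.
  set rho := Num.min _ _ => lrho.
  have rho1 : rho <= 1 by rewrite ge_min lexx.
  have rho2 : (1 - gamma) * rho <= beta - 1.
    by rewrite mulrC -ler_pdivlMr ?subr_gt0// ge_min lexx orbT.
  apply: (@zero_free_near_disk d beta gamma 1 lambda0 rho) => //;
    rewrite ?expr1n ?mulr1 ?ltr0_norm//; first [lra|nra].
move=> /andP[d1]; have d0 : 0 < d%:R :> R by rewrite ltr0n.
have [] := x_checkP b0 g0 bg d0; set x := x_check _ _ _ => eqx bx gx big.
set rho := (_ - 1) / _ => lrho.
(* For beta > 1 the failed degree condition says that the quadratic of [x_checkP] is nonpositive at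
   1. *)
have x1 : 1 <= x.
  have [b1|b1] := leP beta 1; first by nra.
  have g1 : gamma < 1 by nra.
  have bg1 : 0 < (beta - 1) * (1 - gamma) by apply: mulr_gt0; lra.
  apply: big; move: nb; rewrite b1 /= -leNgt -natr1 lerD2r ler_pdivlMr//; lra.
have xd0 : 0 < x ^+ d by apply: exprn_gt0; lra.
have xg0 : 0 < x - gamma by lra.
have rE : rho * x ^+ d = (beta * x - 1) / (x - gamma).
  by rewrite /rho; field; rewrite !lt0r_neq0.
have rE' : (x - gamma) * ((beta * x - 1) / (x - gamma)) = beta * x - 1.
  by rewrite mulrC divfK// lt0r_neq0.
(* From d >= 1. This rearranges to x (beta x - 1) <= x - gamma, that is rho x^(d+1) <= 1, which
   excludes -1. *)
have dle : beta * x ^+ 2 - (1 + beta * gamma) * x + gamma <= x * (1 - beta * gamma).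
  have q1 : 1 <= d%:R :> R by rewrite ler1n.
  have q2 : 0 <= x * (1 - beta * gamma) by nra.
  nra.
apply: (@zero_free_near_disk d beta gamma x lambda0 rho) => //;
  rewrite ?exprSr ?(mulrA rho) ?rE ?ltr0_norm//; try lra.
- by rewrite ler_pdivrMr//; nra.
- by rewrite mulrA ler_pdivrMr//; nra.
- by rewrite mulrAC ler_pdivrMr//; nra.
Qed.

End NegativeFields.

(** * Invariant sectors *)

Section RealInequalities.
Variable R : realType.
Implicit Types (a b x y : R).

Lemma le_of_derive_ge0 (f df : R -> R) a b : a <= b ->
  (forall x, a <= x <= b -> is_derive x 1 f (df x)) ->
  (forall x, a <= x <= b -> 0 <= df x) -> f a <= f b.
Proof.
move=> ab fdf df0.
have [x /[1!in_itv]/= xab|x|c cab fE] := @MVT_segment R f df a b ab.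
- by apply: fdf; case/andP: xab => *; rewrite !ltW.
- apply: continuous_in_subspaceT => {}x; rewrite inE /= in_itv /= => xab.
  by apply/differentiable_continuous/derivable1_diffP; have [] := fdf x xab.
- rewrite -subr_ge0 fE mulr_ge0 ?subr_ge0// df0//.
Qed.

Lemma ln_le_subr1 x : 0 < x -> ln x <= x - 1.
Proof. by move=> x0; have := @le_ln1Dx _ (x - 1); rewrite (addrC 1) subrK; apply; lra. Qed.

Lemma norm_sin_le x : `|sin x| <= `|x|.
Proof.
wlog x0 : x / 0 <= x => [h|].
  have [|x0] := leP 0 x; first exact: h.
  by rewrite -normrN -sinN -[`|x|]normrN h//; lra.
rewrite (ger0_norm x0) ler_norml; apply/andP; split.
  have : (fun y : R => sin y + y) 0 <= (fun y : R => sin y + y) x.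
    apply: (@le_of_derive_ge0 _ (fun y => cos y + 1)) => [//|y _].
    have := cos_geN1 y; lra.
  by rewrite /= sin0; lra.
have : (fun y : R => y - sin y) 0 <= (fun y : R => y - sin y) x.
  apply: (@le_of_derive_ge0 _ (fun y => 1 - cos y)) => [//|y _].
  have := cos_le1 y; lra.
by rewrite /= sin0; lra.
Qed.

Lemma cos_ge_sqr x : 1 - x ^+ 2 / 2 <= cos x.
Proof.
have h := norm_sin_le (x / 2).
have -> : cos x = 1 - 2 * sin (x / 2) ^+ 2.
  rewrite {1}(_ : x = x / 2 + x / 2); last by field.
  by rewrite cosD -!expr2 cos2sin2; ring.
suff : sin (x / 2) ^+ 2 <= (x / 2) ^+ 2 by lra.
by rewrite -real_normK ?num_real// -[leRHS]real_normK ?num_real// ler_pXn2r// nnegrE.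
Qed.

Lemma norm_atan_le x : `|atan x| <= `|x|.
Proof.
wlog x0 : x / 0 <= x => [h|].
  have [|x0] := leP 0 x; first exact: h.
  by rewrite -normrN -atanN -[`|x|]normrN h//; lra.
have a0 : 0 <= atan x by rewrite -(@atan0 R) le_atan.
rewrite !ger0_norm//.
have : (fun y : R => y - atan y) 0 <= (fun y : R => y - atan y) x.
  apply: (@le_of_derive_ge0 _ (fun y => 1 - (1 + y ^+ 2)^-1)) => [//|y _].
  have y2 : 0 <= y ^+ 2 by exact: sqr_ge0.
  by rewrite subr_ge0 invf_le1; lra.
by rewrite /= atan0; lra.
Qed.

Lemma expRN_mul_le x : 0 <= x -> expR (- x) * x <= 1.
Proof.
move=> x0; rewrite expRN mulrC ler_pdivrMr ?expR_gt0// mul1r.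
by have := expR_ge1Dx x; lra.
Qed.

Lemma expRN_mul_sqr_le x : 0 <= x -> expR (- x) * x ^+ 2 <= 2.
Proof.
move=> x0; rewrite expRN mulrC ler_pdivrMr ?expR_gt0//.
have := expR_ge1Dxn 1 x0.
rewrite (_ : 2`!%:R = 2)//; lra.
Qed.

End RealInequalities.

(** * The edge map in logarithmic coordinates *)

Section Edge.
Variable R : realType.
Implicit Types (beta gamma x L A K : R).

(** This is - ln h, and [edge_slope] is E, the absolute value of its derivative with respect to ln
    x. *)
Definition edge_log beta gamma x := ln ((beta + x) / (1 + gamma * x)).

Definition edge_slope beta gamma x :=
  `|1 - beta * gamma| * x / ((1 + gamma * x) * (beta + x)).

Lemma edge_slope_gt0 beta gamma x : 0 < beta -> 0 <= gamma -> beta * gamma != 1 ->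
  0 < x -> 0 < edge_slope beta gamma x.
Proof.
move=> b0 g0 bg x0; rewrite /edge_slope divr_gt0// mulr_gt0//; try nra.
by rewrite normr_gt0 subr_eq0 eq_sym.
Qed.

Lemma edge_slope_le beta gamma x : 0 < beta -> 0 <= gamma -> 0 <= x ->
  edge_slope beta gamma x <= `|1 - beta * gamma| / beta * x.
Proof.
move=> b0 g0 x0; have gx : 0 <= gamma * x by exact: mulr_ge0.
rewrite /edge_slope mulrAC ler_wpM2r// ler_wpM2l// lef_pV2 ?posrE//; nra.
Qed.

Lemma ln_le_sqrt x : 0 < x -> ln x <= 2 * Num.sqrt x.
Proof.
move=> x0; have s0 : 0 < Num.sqrt x by rewrite sqrtr_gt0.
rewrite -{1}(sqr_sqrtr (ltW x0)) lnXn// mulr2n.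
have := ln_le_subr1 s0; lra.
Qed.

(** Makes the strict inequality uniform. For x >= tau^2 the gain is E(x)(K - A), with E bounded
    below by [e0]. Near 0 the slope E degenerates, but E(x)(A - ln x) is O(sqrt x) while the
    right-hand side tends to L + ln beta > 0. *)
Lemma edge_gap beta gamma L A K : 0 < beta -> 0 <= gamma -> beta * gamma != 1 ->
  0 < L + ln beta -> A < K ->
  (forall x, 0 < x -> K <= ln x + (L + edge_log beta gamma x) / edge_slope beta gamma x) ->
  exists eta, [/\ 0 < eta, eta <= L + ln beta &
    forall x, 0 < x -> x <= expR A ->
      edge_slope beta gamma x * (A - ln x) <= L + edge_log beta gamma x - eta].
Proof.
move=> b0 g0 bg Lb AK hK; set m := L + ln beta in Lb *.
set k := `|1 - beta * gamma|.
have k0 : 0 < k by rewrite normr_gt0 subr_eq0 eq_sym.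
set X := expR A; have X0 : 0 < X by exact: expR_gt0.
set C := 2 * (k / beta) * Num.sqrt X.
have kb : 0 < k / beta by exact: divr_gt0.
have C0 : 0 < C by rewrite /C !mulr_gt0 ?invr_gt0 ?sqrtr_gt0.
set tau := Num.min 1 (m / (2 * (gamma + C))).
have gC : 0 < 2 * (gamma + C) by lra.
have tau0 : 0 < tau by rewrite lt_min ltr01 divr_gt0.
have tau1 : tau <= 1 by rewrite ge_min lexx.
have tauE : (gamma + C) * tau <= m / 2.
  have : tau <= m / (2 * (gamma + C)) by rewrite ge_min lexx orbT.
  by rewrite ler_pdivlMr//; lra.
set e0 := k * tau ^+ 2 / ((1 + gamma * X) * (beta + X)).
have e00 : 0 < e0 by rewrite divr_gt0// !mulr_gt0 ?exprn_gt0//; nra.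
exists (Num.min (m / 2) (e0 * (K - A))); split.
- by rewrite lt_min divr_gt0//= mulr_gt0// subr_gt0.
- by rewrite ge_min; apply/orP; left; lra.
move=> x x0 xX; have [xt|xt] := leP (tau ^+ 2) x.
  have E0 := edge_slope_gt0 b0 g0 bg x0.
  have h : edge_slope beta gamma x * (K - ln x) <= L + edge_log beta gamma x.
    by rewrite mulrC -ler_pdivlMr//; have := hK x x0; lra.
  have : e0 <= edge_slope beta gamma x.
    have gx : 0 <= gamma * x by nra.
    have gX : gamma * x <= gamma * X by rewrite ler_wpM2l.
    rewrite /edge_slope; apply: ler_pM.
    - by rewrite mulr_ge0// ?sqr_ge0 ?ltW.
    - by rewrite invr_ge0 mulr_ge0//; lra.
    - by rewrite ler_pM2l.
    - by rewrite lef_pV2 ?posrE ?ler_pM ?mulr_gt0//; lra.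
  move=> e0E; have e0K : e0 * (K - A) <= edge_slope beta gamma x * (K - A).
    by rewrite ler_pM2r ?subr_gt0.
  have : Num.min (m / 2) (e0 * (K - A)) <= e0 * (K - A) by rewrite ge_min lexx orbT.
  lra.
have {xt} : Num.sqrt x <= tau.
  by rewrite -(ger0_norm (ltW tau0)) -sqrtr_sqr ler_wsqrtr// ltW.
move=> xt.
have sx0 : 0 <= Num.sqrt x by exact: sqrtr_ge0.
have xE : x = Num.sqrt x ^+ 2 by rewrite sqr_sqrtr// ltW.
have h1 : A - ln x <= 2 * (Num.sqrt X / Num.sqrt x).
  have := @ln_le_sqrt (X / x); rewrite ln_div ?posrE// expRK sqrtrM ?(ltW X0)// sqrtrV ?(ltW x0)//.
  by apply; exact: divr_gt0.
have h2 : edge_slope beta gamma x * (A - ln x) <= C * Num.sqrt x.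
  have E0 := ltW (edge_slope_gt0 b0 g0 bg x0).
  apply: le_trans (ler_wpM2l E0 h1) _.
  have E1 := edge_slope_le b0 g0 (ltW x0).
  apply: le_trans (ler_wpM2r _ E1) _.
    by rewrite mulr_ge0// divr_ge0 ?sqrtr_ge0.
  rewrite -/k {1}xE /C le_eqVlt; apply/orP; left; apply/eqP.
  by field; rewrite !lt0r_neq0// sqrtr_gt0.
have h3 : ln beta - gamma * x <= edge_log beta gamma x.
  rewrite /edge_log ln_div ?posrE; try nra.
  have : ln beta <= ln (beta + x) by rewrite ler_ln ?posrE; lra.
  have gx : 0 <= gamma * x by nra.
  have := @le_ln1Dx _ (gamma * x); lra.
have : Num.min (m / 2) (e0 * (K - A)) <= m / 2 by rewrite ge_min lexx.
have : gamma * x <= gamma * tau by rewrite ler_wpM2l// xE; nra.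
have : C * Num.sqrt x <= C * tau by rewrite ler_pM2l.
rewrite /m in tauE *; lra.
Qed.

Lemma edge_log0 beta gamma : edge_log beta gamma 0 = ln beta.
Proof. by rewrite /edge_log mulr0 !addr0 divr1. Qed.

Lemma edge_slope0 beta gamma : edge_slope beta gamma 0 = 0.
Proof. by rewrite /edge_slope mulr0 mul0r. Qed.

End Edge.

(** * Sectors in polar form *)

Section Sector.
Variable R : realType.
Implicit Types (L eps : R) (y : R[i]).

Definition polar (r theta : R) : R[i] := (r * cos theta) +i* (r * sin theta).

Lemma polarM r r' theta theta' :
  polar r theta * polar r' theta' = polar (r * r') (theta + theta').
Proof. by apply/eqP; rewrite eq_complex /= cosD sinD; apply/andP; split; apply/eqP; ring. Qed.

Lemma polar_atan (a b : R) : 0 < a ->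
  a +i* b = polar (Num.sqrt (a ^+ 2 + b ^+ 2)) (atan (b / a)).
Proof.
move=> a0; have s0 : Num.sqrt (1 + (b / a) ^+ 2) != 0.
  by rewrite lt0r_neq0// sqrtr_gt0 ltr_pwDl// sqr_ge0.
have -> : Num.sqrt (a ^+ 2 + b ^+ 2) = a * Num.sqrt (1 + (b / a) ^+ 2).
  rewrite -{2}(ger0_norm (ltW a0)) -sqrtr_sqr -sqrtrM ?sqr_ge0//.
  by congr Num.sqrt; field; exact: lt0r_neq0.
rewrite /polar; have c0 : cos (atan (b / a)) != 0 by rewrite cos_atan invr_eq0.
have -> : sin (atan (b / a)) = b / a * cos (atan (b / a)).
  by rewrite -{2}(atanK (b / a)) /tan divfK.
rewrite cos_atan; apply/eqP; rewrite eq_complex /=.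
by apply/andP; split; apply/eqP; field; rewrite ?s0 ?(lt0r_neq0 a0).
Qed.

(* The image under w |-> exp (L - w) of the sector |Im w| <= eps * Re w, with 0
   standing for w = +oo. *)
Definition sector L eps y : Prop :=
  y = 0 \/ exists a theta : R,
    [/\ 0 <= a, `|theta| <= eps * a & y = polar (expR (L - a)) theta].

Lemma sectorM L L' eps y y' : sector L eps y -> sector L' eps y' ->
  sector (L + L') eps (y * y').
Proof.
move=> [->|[a [t [a0 ta ->]]]]; first by left; rewrite mul0r.
move=> [->|[a' [t' [a'0 ta' ->]]]]; first by left; rewrite mulr0.
right; exists (a + a'), (t + t'); split; first exact: addr_ge0.
  by apply: le_trans (ler_normD _ _) _; rewrite mulrDr lerD.
by rewrite polarM -expRD; congr (polar (expR _) _); ring.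
Qed.

Lemma sector_le L L' eps y : 0 <= eps -> L <= L' -> sector L eps y -> sector L' eps y.
Proof.
move=> e0 LL [->|[a [t [a0 ta ->]]]]; first by left.
right; exists (a + (L' - L)), t; split; first by lra.
  by apply: le_trans ta _; apply: ler_wpM2l => //; lra.
by congr (polar (expR _) _); ring.
Qed.

Lemma sector_real L eps (x : R) : 0 <= eps -> 0 < x -> x <= expR L ->
  sector L eps x%:C.
Proof.
move=> e0 x0 xL; right; exists (L - ln x), 0.
have h : ln x <= L by rewrite -ler_expR lnK.
rewrite normr0 mulr_ge0 ?subr_ge0//; split=> //.
by rewrite opprB addrC subrK lnK// /polar cos0 sin0 mulr1 mulr0.
Qed.

Lemma prods_sector L eps n p : 0 <= eps -> 0 <= L ->
  prods (sector L eps) n p -> sector (n%:R * L) eps p.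
Proof.
move=> e0 L0 [l [ln lS] ->].
apply: (@sector_le ((size l)%:R * L)) => //; first by rewrite ler_wpM2r// ler_nat.
elim: l {ln} lS => [|y l IH] lS.
  rewrite big_nil mul0r -[1]/(1%:C); apply: sector_real => //; by rewrite expR0.
rewrite big_cons /= -natr1 mulrDl mul1r addrC; apply: sectorM.
  by apply: lS; rewrite mem_head.
by apply: IH => z zl; apply: lS; rewrite inE zl orbT.
Qed.

End Sector.

(** * Perturbation of the edge map near the real axis *)

Section Step.
Variable R : realType.
Implicit Types (beta gamma x : R).

Lemma moebius_factor beta gamma x (s1 s2 : R) :
  let D := beta + x in let N := (D + s1) ^+ 2 + s2 ^+ 2 in
  let kappa := (beta * gamma - 1) / (D * (1 + gamma * x)) in
  0 < D -> 0 < 1 + gamma * x -> 0 < D + s1 ->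
  let z := (x + s1) +i* s2 in
  beta%:C + z != 0 /\
  (1 + gamma%:C * z) / (beta%:C + z) =
    ((1 + gamma * x) / D)%:C *
    ((1 + kappa * (D ^+ 2 * s1 + D * (s1 ^+ 2 + s2 ^+ 2)) / N) +i* (kappa * (D ^+ 2 * s2) / N)).
Proof.
move=> D N kappa D0 g0 Ds0 z.
have N0 : N != 0 by rewrite lt0r_neq0// ltr_pwDl ?sqr_ge0// exprn_gt0.
have den : beta%:C + z != 0.
  by rewrite eq_complex /= negb_and addrA lt0r_neq0.
split=> //; apply: (mulIf den); rewrite divfK//.
apply/eqP; rewrite eq_complex /=; apply/andP.
rewrite /kappa /N /D; move: (lt0r_neq0 D0) (lt0r_neq0 g0) N0; rewrite /N /D => *.
by split; apply/eqP; field; apply/and3P.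
Qed.

Lemma moebius_coef_le beta gamma x : 0 < beta -> 0 <= gamma -> 0 <= x ->
  `|(beta * gamma - 1) / ((beta + x) * (1 + gamma * x))| <= `|1 - beta * gamma| / beta.
Proof.
move=> b0 g0 x0; have gx := mulr_ge0 g0 x0.
have Dg0 : 0 < (beta + x) * (1 + gamma * x) by rewrite mulr_gt0//; lra.
rewrite normrM normfV (gtr0_norm Dg0) distrC ler_wpM2l//.
by rewrite lef_pV2 ?posrE//; nra.
Qed.

(** The only term of first order in [eps] is kappa s2, which must keep the constant 1 since it is
    compared with the opening of the sector; all else is O(eps^2). *)
Lemma moebius_factor_bounds beta gamma x (s1 s2 eps c0 c1 : R) :
  let D := beta + x in let N := (D + s1) ^+ 2 + s2 ^+ 2 in
  let kappa := (beta * gamma - 1) / (D * (1 + gamma * x)) in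
  let k0 := `|1 - beta * gamma| / beta in
  0 < beta -> 0 <= gamma -> 0 <= x -> 0 < eps -> eps <= 1 -> 0 <= c0 -> 0 <= c1 ->
  `|s1| <= c0 * eps ^+ 2 -> `|s2| <= c1 * eps -> c0 * eps ^+ 2 <= beta / 2 ->
  `|kappa * (D ^+ 2 * s1 + D * (s1 ^+ 2 + s2 ^+ 2)) / N| <=
     k0 * (4 * c0 + 4 * (c0 ^+ 2 + c1 ^+ 2) / beta) * eps ^+ 2 /\
  `|kappa * (D ^+ 2 * s2) / N| <= `|kappa * s2| + k0 * (6 * c0 * c1 / beta) * eps ^+ 2.
Proof.
move=> D N kappa k0 b0 g0 x0 e0 e1 c00 c10 hs1 hs2 small.
have bD : beta <= D by rewrite /D; lra.
have D0 : 0 < D by lra.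
have gx : 1 <= 1 + gamma * x by rewrite lerDl mulr_ge0.
have kap : `|kappa| <= k0 by exact: moebius_coef_le.
have k00 : 0 <= k0 by apply: le_trans kap.
have s1D : `|s1| <= D / 2 by lra.
have s1N : - `|s1| <= s1 by rewrite lerNl -normrN ler_norm.
have Ds1 : D - `|s1| <= D + s1 by lra.
have N1 : (D - `|s1|) ^+ 2 <= N.
  have : (D - `|s1|) ^+ 2 <= (D + s1) ^+ 2 by rewrite ler_pXn2r ?nnegrE//; lra.
  by rewrite /N; have := sqr_ge0 s2; lra.
have N0 : 0 < N by apply: lt_le_trans N1; rewrite exprn_gt0//; lra.
have ND : D ^+ 2 <= 4 * N by nra.
have e20 : 0 < eps ^+ 2 by exact: exprn_gt0.
have e21 : eps ^+ 2 <= 1 by rewrite expr_le1// ltW.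
split.
  rewrite -mulrA -mulrA normrM; apply: ler_pM => //.
  rewrite normrM normfV (gtr0_norm N0) ler_pdivrMr//.
  have ss : s1 ^+ 2 + s2 ^+ 2 <= (c0 ^+ 2 + c1 ^+ 2) * eps ^+ 2.
    have q1 : s1 ^+ 2 <= (c0 * eps ^+ 2) ^+ 2.
      by rewrite -[s1 ^+ 2]real_normK ?num_real// ler_pXn2r ?nnegrE// mulr_ge0// ltW.
    have q2 : s2 ^+ 2 <= (c1 * eps) ^+ 2.
      by rewrite -[s2 ^+ 2]real_normK ?num_real// ler_pXn2r ?nnegrE// mulr_ge0// ltW.
    have q3 : (c0 * eps ^+ 2) ^+ 2 <= c0 ^+ 2 * eps ^+ 2.
      rewrite exprMn ler_wpM2l ?sqr_ge0//; nra.
    by rewrite mulrDl (exprMn _ c1) in q2 *; lra.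
  apply: le_trans (ler_normD _ _) _.
  have t1 : `|D ^+ 2 * s1| <= 4 * c0 * eps ^+ 2 * N.
    rewrite normrM ger0_norm ?sqr_ge0//.
    apply: le_trans (ler_pM (sqr_ge0 D) (normr_ge0 s1) ND hs1) _; lra.
  have t2 : `|D * (s1 ^+ 2 + s2 ^+ 2)| <= 4 * (c0 ^+ 2 + c1 ^+ 2) / beta * eps ^+ 2 * N.
    have ss0 : 0 <= s1 ^+ 2 + s2 ^+ 2 by rewrite addr_ge0 ?sqr_ge0.
    have DN : D <= 4 * N / beta by rewrite ler_pdivlMr//; nra.
    rewrite (ger0_norm (mulr_ge0 (ltW D0) ss0)).
    apply: le_trans (ler_pM (ltW D0) ss0 DN ss) _.
    by rewrite le_eqVlt; apply/orP; left; apply/eqP; ring.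
  lra.
(* 1 / (1 - u)^2 <= 1 + 6 u for 0 <= u <= 1/2, with u = |s1| / D. *)
have key : D ^+ 2 <= N * (1 + 6 * (`|s1| / D)).
  set u := `|s1| / D.
  have uD : `|s1| = u * D by rewrite /u divfK// lt0r_neq0.
  have u0 : 0 <= u by rewrite divr_ge0// ltW.
  have u1 : u <= 1 / 2 by rewrite /u ler_pdivrMr//; lra.
  clearbody u.
  apply: le_trans (_ : (D - `|s1|) ^+ 2 * (1 + 6 * u) <= _); last first.
    by rewrite ler_wpM2r//; lra.
  rewrite uD (_ : (D - u * D) ^+ 2 * (1 + 6 * u) =
    D ^+ 2 + D ^+ 2 * (u * (1 - 2 * u) * (4 - 3 * u))); last ring.
  by rewrite lerDl !mulr_ge0 ?sqr_ge0//; lra.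
rewrite [`|_ / N|]normrM normfV (gtr0_norm N0) ler_pdivrMr// mulrCA normrM mulrC.
rewrite (ger0_norm (sqr_ge0 D)).
apply: le_trans (ler_wpM2l (normr_ge0 _) key) _.
rewrite mulrCA mulrC ler_wpM2r ?(ltW N0)// mulrDr mulr1 lerD2l normrM.
have : `|s1| / D <= c0 * eps ^+ 2 / beta.
  by rewrite ler_pM ?invr_ge0 ?(ltW D0)// lef_pV2 ?posrE.
have : `|kappa| * `|s2| <= k0 * (c1 * eps) by rewrite ler_pM.
set a := _ * `|s2|; set u := `|s1| / D => ha hu.
have a0 : 0 <= a by rewrite mulr_ge0.
have u0 : 0 <= u by rewrite divr_ge0// ltW.
apply: le_trans (_ : (k0 * (c1 * eps)) * (6 * (c0 * eps ^+ 2 / beta)) <= _).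
  by clearbody a u; apply: ler_pM => //; lra.
rewrite (_ : _ * _ = (k0 * (6 * c0 * c1 / beta) * eps ^+ 2) * eps); last ring.
rewrite ler_piMr// !mulr_ge0 ?invr_ge0// ltW//.
Qed.

End Step.

(** * Invariance of thin sectors *)

Section Master.
Variable R : realType.
Implicit Types (beta gamma x L P K eps q theta t : R).

Lemma normc_polar (r theta : R) : 0 <= r -> normc (polar r theta) = r.
Proof.
move=> r0; rewrite /= !exprMn -mulrDr cos2Dsin2 mulr1 sqrtr_sqr ger0_norm//.
Qed.

Lemma Re_Im_le_normc (z : R[i]) : `|Re z| <= normc z /\ `|Im z| <= normc z.
Proof.
case: z => a b /=; rewrite -!sqrtr_sqr; split; apply: ler_wsqrtr.
  by rewrite lerDl sqr_ge0.
by rewrite lerDr sqr_ge0.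
Qed.

(** Here rho1 + i rho2 is the relative factor of [moebius_factor], and [a] is the real part of w for
    the image point. To first order the angle is at most eps q while a >= q + eta, so the gap [eta]
    absorbs the errors of order eps^2. *)
Lemma sector_estimate (rho1 rho2 eps m q W eta C3 C4 C7 : R) :
  let C5 := C7 + C4 in let C6 := 2 * C3 + C3 ^+ 2 + C5 ^+ 2 in
  0 < eps -> eps <= 1 -> 0 <= C3 -> 0 <= C4 -> 0 <= q -> q <= C7 ->
  0 <= m -> m <= eps * q -> 0 < eta -> q + eta <= W ->
  `|rho1 - 1| <= C3 * eps ^+ 2 -> `|rho2| <= m + C4 * eps ^+ 2 ->
  eps * C3 < 1 -> eps * (C4 + C6 / 2 + C3 * (C7 + eta)) <= eta ->
  let a := W - ln (rho1 ^+ 2 + rho2 ^+ 2) / 2 in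
  [/\ 0 < rho1, 0 <= a & `|rho2 / rho1| <= eps * a].
Proof.
move=> C5 C6 e0 e1 C30 C40 q0 qC m0 mq eta0 qW h1 h2 eC3 eT a.
have e20 : 0 < eps ^+ 2 by exact: exprn_gt0.
have e2e : eps ^+ 2 <= eps by rewrite expr2 ger_pMl.
have C3e : C3 * eps ^+ 2 <= eps * C3 by rewrite mulrC ler_wpM2r.
have C4e : C4 * eps ^+ 2 <= eps * C4 by rewrite mulrC ler_wpM2r.
have [r1 r1'] : 1 - C3 * eps ^+ 2 <= rho1 /\ rho1 <= 1 + C3 * eps ^+ 2.
  by move: h1; rewrite ler_norml => /andP[]; lra.
have rho10 : 0 < rho1 by lra.
have C50 : 0 <= C5 by rewrite /C5; lra.
have r2 : `|rho2| <= C5 * eps.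
  apply: le_trans h2 _; rewrite /C5; have : eps * q <= eps * C7 by rewrite ler_pM2l.
  lra.
have C60 : 0 <= C6 by rewrite /C6 !addr_ge0 ?sqr_ge0//; lra.
have N1 : rho1 ^+ 2 + rho2 ^+ 2 <= 1 + C6 * eps ^+ 2.
  have k1 : rho1 ^+ 2 <= (1 + C3 * eps ^+ 2) ^+ 2.
    by rewrite ler_pXn2r ?nnegrE//; lra.
  have k2 : rho2 ^+ 2 <= (C5 * eps) ^+ 2.
    by rewrite -[rho2 ^+ 2]real_normK ?num_real// ler_pXn2r ?nnegrE//; nra.
  have k3 : (C3 * eps ^+ 2) ^+ 2 <= C3 ^+ 2 * eps ^+ 2.
    by rewrite exprMn ler_wpM2l ?sqr_ge0// expr2 ger_pMl//; lra.
  by rewrite (exprMn _ C5) in k2; rewrite /C6; lra.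
have N0 : 0 < rho1 ^+ 2 + rho2 ^+ 2 by rewrite ltr_pwDl ?sqr_ge0// exprn_gt0.
have lnN : ln (rho1 ^+ 2 + rho2 ^+ 2) <= C6 * eps ^+ 2.
  by apply: le_trans (ln_le_subr1 N0) _; lra.
have C6e : C6 * eps ^+ 2 <= eps * C6 by rewrite mulrC ler_wpM2r.
have C7e : 0 <= C3 * (C7 + eta) by rewrite mulr_ge0//; lra.
set a0 := q + eta - C6 * eps ^+ 2 / 2.
have a0a : a0 <= a by rewrite /a0 /a; lra.
have a00 : 0 <= a0 by rewrite /a0; nra.
split=> //; first by lra.
rewrite normrM normfV (gtr0_norm rho10) ler_pdivrMr//.
apply: le_trans (_ : eps * a0 * (1 - C3 * eps ^+ 2) <= _); last first.
  apply: ler_pM => //; first by nra.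
    lra.
  by rewrite ler_pM2l.
apply: le_trans h2 _.
have k4 : C3 * eps ^+ 2 * a0 <= eps * (C3 * (C7 + eta)).
  rewrite mulrAC mulrC; apply: ler_pM => //.
  - exact: ltW.
  - by rewrite mulr_ge0.
  - rewrite ler_wpM2l//; rewrite /a0.
    have : 0 <= C6 * eps ^+ 2 by rewrite mulr_ge0// ltW.
    lra.
have k5 : q + C4 * eps <= a0 * (1 - C3 * eps ^+ 2) by have a0E : a0 = q + eta - C6 * eps ^+ 2 / 2 by []; lra.
have := ler_wpM2l (ltW e0) k5; rewrite !mulrA; lra.
Qed.

(** A point of the sector with Re w = q is sent to one with real part about L - ln h(x), and its
    angle is multiplied by about E(x). The hypothesis thus says that the image stays inside with
    margin [eta]; [zeta] is the deviation of the field from the real segment. *)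
Lemma sector_step beta gamma L P lambda0 eta : 0 < beta -> 0 <= gamma ->
  0 < lambda0 -> 0 < eta -> 0 < L + ln beta ->
  (forall t q, 0 <= t -> t <= lambda0 -> 0 <= q ->
     let x := t * expR (P - q) in
     edge_slope beta gamma x * q + eta <= L + edge_log beta gamma x) ->
  exists2 T, 0 < T & forall eps, 0 < eps -> eps * T <= 1 ->
    forall t (zeta p : R[i]), 0 <= t -> t <= lambda0 -> normc zeta <= eps ^+ 2 ->
      sector P eps p -> let z := (t%:C + zeta) * p in
      beta%:C + z != 0 /\ sector L eps ((1 + gamma%:C * z) / (beta%:C + z)).
Proof.
move=> b0 g0 l0 eta0 Lb gap.
set Q := expR P; have Q0 : 0 < Q by exact: expR_gt0.
set X := lambda0 * Q; have X0 : 0 < X by exact: mulr_gt0.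
pose k0 := `|1 - beta * gamma| / beta.
have k00 : 0 <= k0 by rewrite divr_ge0// ltW.
pose C0 := X + Q; have C00 : 0 < C0 by rewrite addr_gt0.
pose C3 := k0 * (4 * C0 + 4 * (C0 ^+ 2 + C0 ^+ 2) / beta).
have C30 : 0 <= C3.
  by rewrite mulr_ge0// addr_ge0 ?divr_ge0 ?mulr_ge0 ?addr_ge0 ?sqr_ge0// ltW.
pose C4 := k0 * Q + k0 * (6 * C0 * C0 / beta).
have C40 : 0 <= C4.
  by apply: addr_ge0; rewrite !mulr_ge0 ?invr_ge0 ?(ltW C00) ?(ltW Q0) ?(ltW b0).
pose C7 := k0 * X; have C70 : 0 <= C7 by rewrite mulr_ge0// ltW.
pose C6 := 2 * C3 + C3 ^+ 2 + (C7 + C4) ^+ 2.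
have C60 : 0 <= C6 by rewrite addr_ge0 ?sqr_ge0// addr_ge0 ?sqr_ge0// mulr_ge0.
pose C8 := C4 + C6 / 2 + C3 * (C7 + eta).
have C80 : 0 <= C8.
  have k1 : 0 <= C3 * (C7 + eta) by rewrite mulr_ge0//; lra.
  by rewrite /C8; lra.
(* The four summands ensure eps <= 1, C0 eps^2 <= beta / 2, eps C3 < 1 and eps C8 <= eta. *)
exists (1 + 2 * C0 / beta + 2 * C3 + C8 / eta).
  have k1 : 0 <= 2 * C0 / beta by rewrite divr_ge0 ?mulr_ge0// ltW.
  have k2 : 0 <= C8 / eta by rewrite divr_ge0// ltW.
  lra.
move=> eps e0; rewrite !(mulrDr eps) mulr1 => eT.
have T1 : 0 <= eps * (2 * C0 / beta) by rewrite !mulr_ge0 ?invr_ge0 ?(ltW e0) ?(ltW C00) ?(ltW b0).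
have T2 : 0 <= eps * (2 * C3) by rewrite mulr_ge0 ?(ltW e0)// mulr_ge0.
have T3 : 0 <= eps * (C8 / eta) by rewrite mulr_ge0 ?(ltW e0)// divr_ge0// ltW.
have e1 : eps <= 1 by lra.
have eC8 : eps * C8 <= eta by rewrite -[leRHS]mul1r -ler_pdivrMr// -mulrA; lra.
have e2e : eps ^+ 2 <= eps by rewrite expr2 ger_pMl.
have e20 : 0 < eps ^+ 2 by exact: exprn_gt0.
have eC0 : C0 * eps ^+ 2 <= beta / 2.
  have : eps * (2 * C0) <= beta by rewrite -[leRHS]mul1r -ler_pdivrMr// -mulrA; lra.
  have : C0 * eps ^+ 2 <= C0 * eps by rewrite ler_pM2l.
  lra.
move=> t zeta p t0 tl hz [->|[q [theta [q0 hq ->]]]].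
  rewrite mulr0 => z; rewrite /z mulr0 !addr0; split; first by rewrite eq_complex /= negb_and lt0r_neq0.
  rewrite mul1r -fmorphV /=; apply: sector_real; rewrite ?invr_gt0//; first exact: ltW.
  by rewrite -[leLHS]lnK ?posrE ?invr_gt0// ler_expR lnV ?posrE//; lra.
set pp := polar _ _ => z; set x := t * expR (P - q).
have := gap t q t0 tl q0; rewrite -/x => gapx {gap}.
have Eq0 : 0 <= expR (- q) <= 1 by rewrite expR_ge0 expR_le1; lra.
have xE : x = t * Q * expR (- q) by rewrite /x expRD mulrA.
have x0 : 0 <= x by rewrite mulr_ge0// expR_ge0.
have tQ0 : 0 <= t * Q by rewrite mulr_ge0// ltW.
have tQX : t * Q <= X by rewrite /X ler_wpM2r// ltW.
(* As x decays like exp(-q), the products x q and x q^2 are bounded, which makes the estimates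
   uniform over the unbounded sector. *)
have xq : x * q <= X.
  rewrite xE -mulrA -[leRHS]mulr1; apply: ler_pM => //; last exact: expRN_mul_le.
  by rewrite mulr_ge0// expR_ge0.
have xq2 : x * q ^+ 2 <= 2 * X.
  rewrite xE -mulrA [leRHS]mulrC; apply: ler_pM => //; last exact: expRN_mul_sqr_le.
  by rewrite mulr_ge0 ?expR_ge0 ?sqr_ge0.
have pn : normc (zeta * pp) <= Q * eps ^+ 2.
  rewrite normcM normc_polar ?expR_ge0// expRD -/Q mulrC ler_pM ?normc_ge0 ?mulr_ge0 ?expR_ge0 ?(ltW Q0)//.
  by rewrite ger_pMr//; lra.
have [zr zi] := Re_Im_le_normc (zeta * pp).
set s1 := x * (cos theta - 1) + Re (zeta * pp).
set s2 := x * sin theta + Im (zeta * pp).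
have zE : z = (x + s1) +i* s2.
  rewrite /z mulrDl /s1 /s2; case: (zeta * pp) => a b.
  rewrite /pp /polar /x; apply/eqP; rewrite eq_complex /=.
  by apply/andP; split; apply/eqP; ring.
have th2 : theta ^+ 2 <= eps ^+ 2 * q ^+ 2.
  by rewrite -exprMn -[theta ^+ 2]real_normK ?num_real// ler_pXn2r ?nnegrE// mulr_ge0// ltW.
have hs1 : `|s1| <= C0 * eps ^+ 2.
  apply: le_trans (ler_normD _ _) _; rewrite /C0 mulrDl lerD//; last exact: le_trans pn.
  rewrite normrM (ger0_norm x0) distrC ger0_norm; last by have := cos_le1 theta; lra.
  have := cos_ge_sqr theta; move=> hc.
  apply: le_trans (_ : x * (eps ^+ 2 * q ^+ 2 / 2) <= _); first by rewrite ler_wpM2l//; lra.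
  have := ler_wpM2l (ltW e20) xq2; lra.
have xsin : `|x * sin theta| <= x * `|theta|.
  by rewrite normrM (ger0_norm x0) ler_wpM2l// norm_sin_le.
have xth : x * `|theta| <= eps * (x * q) by rewrite mulrCA ler_wpM2l.
have hs2 : `|s2| <= C0 * eps.
  apply: le_trans (ler_normD _ _) _; rewrite /C0 mulrDl lerD//.
    apply: le_trans xsin _; apply: le_trans xth _; rewrite mulrC ler_wpM2r//; exact: ltW.
  by apply: le_trans zi _; apply: le_trans pn _; rewrite ler_pM2l.
have D0 : 0 < beta + x by rewrite ltr_pwDl.
have gx : 0 < 1 + gamma * x by rewrite ltr_pwDl// mulr_ge0.
have Ds : 0 < beta + x + s1.
  have : `|s1| < beta by apply: le_lt_trans (le_trans hs1 eC0) _; rewrite ltr_pdivrMr//; lra.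
  by rewrite ltr_norml => /andP[h _]; rewrite addrAC ltr_wpDr// -ltrBlDl sub0r.
have [den yE] := @moebius_factor _ beta gamma x s1 s2 D0 gx Ds.
have [] := @moebius_factor_bounds _ beta gamma x s1 s2 eps C0 C0 b0 g0 x0 e0 e1
  (ltW C00) (ltW C00) hs1 hs2 eC0.
rewrite -/k0 -/C3 zE; move: yE; rewrite -zE.
set kappa := (_ - 1) / _; set r1 := kappa * _ / _; set r2 := kappa * _ / _.
move=> yE hr1 hr2; split; first by rewrite zE.
have kap : `|kappa| <= k0 by exact: moebius_coef_le.
have kapx : `|kappa| * x = edge_slope beta gamma x.
  rewrite /kappa /edge_slope normrM normfV distrC [`|_ * (1 + _)|]gtr0_norm ?mulr_gt0//.
  by rewrite mulrAC [(1 + _) * _]mulrC.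
set m := edge_slope beta gamma x * `|theta|.
have kaps2 : `|kappa * s2| <= m + k0 * Q * eps ^+ 2.
  rewrite normrM; apply: le_trans (ler_wpM2l (normr_ge0 _) (ler_normD _ _)) _.
  rewrite mulrDr lerD//.
    apply: le_trans (ler_wpM2l (normr_ge0 _) xsin) _.
    by rewrite mulrA kapx.
  rewrite -mulrA ler_pM//; exact: le_trans pn.
have E0 : 0 <= edge_slope beta gamma x by rewrite -kapx mulr_ge0.
have [] := @sector_estimate (1 + r1) r2 eps m (edge_slope beta gamma x * q)
  (L + edge_log beta gamma x) eta C3 C4 C7 e0 e1 C30 C40 => //.
- exact: mulr_ge0.
- rewrite -kapx -mulrA /C7 ler_pM// mulr_ge0//.
- exact: mulr_ge0.
- by rewrite mulrCA ler_wpM2l.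
- by rewrite addrC addKr.
- by apply: le_trans hr2 _; rewrite /C4; lra.
- by lra.
move=> r10 a0 ha.
rewrite yE; right; eexists; eexists; split; [exact: a0| |].
  exact: le_trans (norm_atan_le _) ha.
rewrite (polar_atan _ r10).
have -> (a b : R) : a%:C * polar b (atan (r2 / (1 + r1))) = polar (a * b) (atan (r2 / (1 + r1))).
  by apply/eqP; rewrite eq_complex /=; apply/andP; split; apply/eqP; ring.
congr polar.
have -> : L - (L + edge_log beta gamma x - ln ((1 + r1) ^+ 2 + r2 ^+ 2) / 2) =
  - edge_log beta gamma x + ln ((1 + r1) ^+ 2 + r2 ^+ 2) / 2 by ring.
rewrite expRD expRN /edge_log lnK ?posrE ?divr_gt0// invf_div; congr (_ * _).
have N0 : 0 < (1 + r1) ^+ 2 + r2 ^+ 2 by rewrite ltr_pwDl ?sqr_ge0// exprn_gt0.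
by rewrite expRM lnK ?posrE// powR12_sqrt// ltW.
Qed.

(** To come near -1 the cosine must be negative, hence |theta| >= 1 and eps q >= 1. Then exp(-q) <=
    eps, so the product is too small to reach -1. *)
Lemma sector_last P lambda0 : 0 < lambda0 ->
  exists2 T, 0 < T & forall eps, 0 < eps -> eps * T <= 1 ->
    forall t (zeta p : R[i]), 0 <= t -> t <= lambda0 -> normc zeta <= eps ^+ 2 ->
      sector P eps p -> 1 + (t%:C + zeta) * p != 0.
Proof.
move=> l0; set Q := expR P; have Q0 : 0 < Q by exact: expR_gt0.
exists (1 + lambda0 * Q + Q).
  by rewrite -addrA ltr_pwDl// addr_ge0 ?mulr_ge0// ltW.
move=> eps e0 eT t zeta p t0 tl hz.
have lQ0 : 0 <= eps * (lambda0 * Q) by rewrite !mulr_ge0// ltW.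
have eQ0 : 0 <= eps * Q by rewrite mulr_ge0// ltW.
have e1 : eps <= 1 by lra.
have e2e : eps ^+ 2 <= eps by rewrite expr2 ger_pMl.
move=> [->|[q [theta [q0 hq ->]]]]; first by rewrite mulr0 addr0 oner_neq0.
set p0 := polar _ _.
have pn : normc (zeta * p0) <= eps * Q.
  rewrite normcM normc_polar ?expR_ge0//; apply: ler_pM; rewrite ?normc_ge0 ?expR_ge0//.
    exact: le_trans e2e.
  by rewrite ler_expR; lra.
have [zr _] := Re_Im_le_normc (zeta * p0).
have {}zr : - (eps * Q) <= Re (zeta * p0).
  by have := le_trans zr pn; rewrite ler_norml => /andP[].
suff h : - (eps * (lambda0 * Q)) <= t * expR (P - q) * cos theta.
  apply/eqP => /(congr1 (@complex.Re R)); rewrite mulrDl.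
  have -> : Re (1 + (t%:C * p0 + zeta * p0)) =
      1 + t * expR (P - q) * cos theta + Re (zeta * p0).
    by case: (zeta * p0) => a b; rewrite /p0 /polar /=; ring.
  by rewrite [X in _ = X]/=; lra.
have x0 : 0 <= t * expR (P - q) by rewrite mulr_ge0// expR_ge0.
have [c0|c0] := leP 0 (cos theta).
  by apply: le_trans (_ : 0 <= _); [lra|exact: mulr_ge0].
have th1 : 1 <= `|theta|.
  rewrite leNgt; apply/negP => th.
  have th2 : theta ^+ 2 < 1.
    by rewrite -[theta ^+ 2]real_normK ?num_real// expr_lt1.
  by have := cos_ge_sqr theta; lra.
have eq1 : 1 <= eps * q by exact: le_trans hq.
have Eq : expR (- q) <= eps.
  have := expRN_mul_le q0 => h; rewrite -[leRHS]mulr1.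
  apply: le_trans (_ : eps * (expR (- q) * q) <= _); last by rewrite ler_pM2l.
  by rewrite mulrCA ler_peMr// expR_ge0.
have xE : t * expR (P - q) <= eps * (lambda0 * Q).
  rewrite expRD -/Q mulrA [leRHS]mulrC; apply: ler_pM => //.
  - by rewrite mulr_ge0// ltW.
  - by rewrite ler_wpM2r// ltW.
have := cos_geN1 theta; nra.
Qed.

Lemma zero_free_near_sector d beta gamma L P lambda0 K :
  0 < beta -> 0 <= gamma -> beta * gamma != 1 ->
  0 <= L -> gamma <= expR L -> 0 < L + ln beta -> d%:R * L <= P ->
  0 < lambda0 -> ln lambda0 + P < K ->
  (forall x, 0 < x -> K <= ln x + (L + edge_log beta gamma x) / edge_slope beta gamma x) ->
  zero_free_near d.+1 beta gamma lambda0.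
Proof.
move=> b0 g0 bg L0 gL Lb dP l0 lK hK.
have [eta [eta0 etab gap]] := edge_gap b0 g0 bg Lb lK hK.
have [|T T0 step] := @sector_step beta gamma L P lambda0 eta b0 g0 l0 eta0 Lb.
  (* At t = 0 the slope vanishes and the claim is eta <= L + ln beta. For t > 0, q is at most ln
     lambda0 + P - ln x. *)
  move=> t q t0 tl q0 /=; set x := t * expR _; have [t00|t00] := eqVneq t 0.
    by rewrite /x t00 mul0r edge_slope0 mul0r add0r edge_log0.
  have {t00}t0 : 0 < t by rewrite lt_def t00.
  have x0 : 0 < x by rewrite mulr_gt0// expR_gt0.
  have lx : ln x = ln t + (P - q) by rewrite lnM ?posrE ?expR_gt0// expRK.
  have lt : ln t <= ln lambda0 by rewrite ler_ln.
  have := gap x x0; rewrite -[x <= _]ler_ln ?posrE ?expR_gt0// expRK lx => /(_ _).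
  have E0 := ltW (edge_slope_gt0 b0 g0 bg x0).
  have : edge_slope beta gamma x * q <=
      edge_slope beta gamma x * (ln lambda0 + P - (ln t + (P - q))).
    by rewrite ler_wpM2l//; lra.
  by move=> h1 h2; have := h2 ltac:(lra); lra.
have [T' T'0 last] := @sector_last (d.+1%:R * L) lambda0 l0.
set eps := (T + T')^-1.
have TT : 0 < T + T' by lra.
have e0 : 0 < eps by rewrite invr_gt0.
have eTT : eps * (T + T') = 1 by rewrite mulVf// lt0r_neq0.
have eT : eps * T <= 1 by rewrite -eTT ler_pM2l//; lra.
have eT' : eps * T' <= 1 by rewrite -eTT ler_pM2l//; lra.
exists (eps ^+ 2); split; first exact: exprn_gt0.
(* A field within eps^2 of the segment causes only second-order errors, which the gap absorbs. *)
move=> lambda [t [t0 tl]]; rewrite normc_complex ltcR => lt l1.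
have lE : lambda = t%:C + (lambda - t%:C) by rewrite addrC subrK.
move: t0 tl; rewrite min_l ?(ltW l0)// max_r ?(ltW l0)// => t0 tl.
move=> V e eG deg S tau feas.
apply: (@partition_function_neq0 _ _ _ _ _ d (sector L eps)) => //.
- exact: lt0r_neq0.
- rewrite -fmorphV /=; apply: sector_real; rewrite ?invr_gt0//; first exact: ltW.
  by rewrite -[leLHS]lnK ?posrE ?invr_gt0// ler_expR lnV ?posrE//; lra.
- have [->|gn0] := eqVneq gamma 0; first by left.
  by apply: sector_real => //; [exact: ltW|rewrite lt_def gn0].
- move=> p /(prods_sector (ltW e0) L0)/(sector_le (ltW e0) dP) pP.
  by have := step eps e0 eT t (lambda - t%:C) p t0 tl (ltW lt) pP; rewrite -lE.
- move=> p /(prods_sector (ltW e0) L0) pP.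
  by have := last eps e0 eT' t (lambda - t%:C) p t0 tl (ltW lt) pP; rewrite -lE.
Qed.

End Master.

(** * Positive fields in the ferromagnetic case *)

Section Potential.
Variable R : realType.
Implicit Types (beta gamma x L : R).

Lemma is_derive_affine_ln (a b x : R) : 0 < a + b * x ->
  is_derive x 1 (fun y => ln (a + b * y)) (b / (a + b * x)).
Proof.
move=> h.
have d1 : is_derive x 1 (fun y : R => a + b * y) b.
  by apply: is_derive_eq; rewrite add0r mul1r; exact: mulr1.
have := @is_derive1_comp _ (@ln R) _ x _ _ (is_derive1_ln h) d1.
by rewrite mulrC.
Qed.


(** The function k of the overview, with 1 / E expanded and the logarithms split so that its
    derivative is read off termwise. *)
Definition log_potential beta gamma L x :=
  ln x + (L + ln (beta + 1 * x) - ln (1 + gamma * x)) *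
    ((gamma * x + beta * x^-1 + (1 + beta * gamma)) / `|1 - beta * gamma|).

Lemma is_derive_log_potential beta gamma L x : 0 < beta -> 0 <= gamma ->
  beta * gamma != 1 -> 0 < x ->
  is_derive x 1 (log_potential beta gamma L)
    (x^-1 + (1 - beta * gamma) / `|1 - beta * gamma| / x +
     (L + ln (beta + 1 * x) - ln (1 + gamma * x)) * (gamma - beta / x ^+ 2) / `|1 - beta * gamma|).
Proof.
move=> b0 g0 bg x0.
have gx := mulr_ge0 g0 (ltW x0).
have d1 : is_derive x 1 (fun y => ln (beta + 1 * y)) (1 / (beta + 1 * x)).
  by apply: is_derive_affine_ln; lra.
have d2 : is_derive x 1 (fun y => ln (1 + gamma * y)) (gamma / (1 + gamma * x)).
  by apply: is_derive_affine_ln; lra.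
have d3 := is_derive1_ln x0.
have d4 : is_derive x 1 (fun y : R => y^-1) (- x ^- 2).
  have := @is_deriveV R id x 1 1 (lt0r_neq0 x0) (is_derive_id _ _).
  by rewrite scaler1.
apply: is_derive_eq.
rewrite /GRing.scale /=.
have n0 : `|1 - beta * gamma| != 0 by rewrite normr_eq0 subr_eq0 eq_sym.
field; rewrite n0 !lt0r_neq0//; lra.
Qed.

Lemma log_potentialE beta gamma L x : 0 < beta -> 0 <= gamma ->
  beta * gamma != 1 -> 0 < x ->
  ln x + (L + edge_log beta gamma x) / edge_slope beta gamma x =
  log_potential beta gamma L x.
Proof.
move=> b0 g0 bg x0; have gx := mulr_ge0 g0 (ltW x0).
have n0 : `|1 - beta * gamma| != 0 by rewrite normr_eq0 subr_eq0 eq_sym.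
rewrite /log_potential /edge_log mul1r ln_div ?posrE; try lra.
rewrite addrA; congr (_ + _ * _); rewrite /edge_slope.
by field; rewrite n0 !lt0r_neq0//; lra.
Qed.

(* The derivative of [log_potential] with respect to [ln x]. *)
Definition log_potential_slope beta gamma L x :=
  1 + (1 - beta * gamma) / `|1 - beta * gamma| +
  (L + edge_log beta gamma x) * (gamma * x - beta / x) / `|1 - beta * gamma|.

Lemma log_potential_min beta gamma L (xh x : R) : 0 < beta -> 0 <= gamma ->
  beta * gamma != 1 -> 0 < xh -> 0 < x ->
  (forall y : R, 0 < y -> y <= xh -> log_potential_slope beta gamma L y <= 0) ->
  (forall y : R, xh <= y -> 0 <= log_potential_slope beta gamma L y) ->
  log_potential beta gamma L xh <= log_potential beta gamma L x.
Proof.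
move=> b0 g0 bg xh0 x0 neg pos.
have n0 : `|1 - beta * gamma| != 0 by rewrite normr_eq0 subr_eq0 eq_sym.
have dE (y : R) : 0 < y -> is_derive y 1 (log_potential beta gamma L)
    (log_potential_slope beta gamma L y / y).
  move=> y0; have gy := mulr_ge0 g0 (ltW y0).
  apply: (is_derive_eq (is_derive_log_potential L b0 g0 bg y0)).
  rewrite /log_potential_slope /edge_log ln_div ?posrE; try lra.
  by rewrite mul1r; field; rewrite n0 lt0r_neq0.
have [xhx|xxh] := leP xh x.
  apply: (@le_of_derive_ge0 _ _ (fun y => log_potential_slope beta gamma L y / y)) => // y /andP[hy _].
    by apply: dE; lra.
  by rewrite divr_ge0 ?pos//; lra.
rewrite -lerN2.
apply: (@le_of_derive_ge0 _ (fun y => - log_potential beta gamma L y)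
  (fun y => - (log_potential_slope beta gamma L y / y))) => [|y /andP[hy _]|y /andP[hy hy']].
- exact: ltW.
- have := dE y (lt_le_trans x0 hy); exact: is_deriveN.
- rewrite oppr_ge0 mulr_le0_ge0 ?neg// ?invr_ge0; lra.
Qed.

End Potential.

Section FerromagneticPositive.
Variable R : realType.
Implicit Types (beta gamma lambda : R).

Lemma zero_free_near_condition1 Delta beta gamma lambda0 : (0 < Delta)%N ->
  0 < beta -> 0 <= gamma -> condition1 Delta beta gamma lambda0 ->
  zero_free_near Delta beta gamma lambda0.
Proof.
case: Delta => // d _ b0 g0 [bg l0]; set s := Num.sqrt _; set M := Num.max 1 gamma => hl.
have g1 : 0 < gamma by nra.
have s1 : 1 < s by rewrite -sqrtr1 ltr_sqrt//; lra.
have M1 : 1 <= M by rewrite le_max lexx.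
have gM : gamma <= M by rewrite le_max lexx orbT.
have M0 : 0 < M by lra.
have bM : 1 < M * beta by rewrite /M; case: (leP 1 gamma) => h; nra.
(* r = sqrt(beta / gamma), the minimiser; in terms of [s] and [r] the potential there is rational
   apart from logarithms. *)
pose r := s / gamma.
have sE : s ^+ 2 = beta * gamma by rewrite sqr_sqrtr//; lra.
have r0 : 0 < r by rewrite divr_gt0//; lra.
have sr : s = gamma * r by rewrite mulrC divfK ?lt0r_neq0.
have bE : beta = gamma * r ^+ 2.
  by apply: (mulfI (lt0r_neq0 g1)); rewrite mulrC -sE sr; ring.
have bgE : beta / gamma = r ^+ 2 by rewrite bE mulrC mulKf// lt0r_neq0.
have bgn : beta * gamma != 1 by rewrite gt_eqF.
have absE : `|1 - beta * gamma| = beta * gamma - 1 by rewrite ltr0_norm; lra.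
have L0 : 0 <= ln M by exact: ln_ge0.
have kE : log_potential beta gamma (ln M) r =
    2 * s / (s - 1) * ln r + (2 * s / (s - 1) - 1) * ln M.
  rewrite /log_potential absE -sE -sr mul1r.
  have -> : beta + r = r * (1 + s) by rewrite bE sr; ring.
  have s10 : 0 < 1 + s by lra.
  rewrite (lnM (x := r)) ?posrE//.
  have -> : beta * r^-1 = s by rewrite bE sr; field; exact: lt0r_neq0.
  by field; apply/andP; split; apply: lt0r_neq0; nra.
refine (@zero_free_near_sector _ d beta gamma (ln M) (d%:R * ln M) lambda0
  (log_potential beta gamma (ln M) r) _ _ _ _ _ _ _ _ _ _) => //.
- by rewrite lnK.
- by rewrite -lnM ?posrE// ln_gt0.
- move: hl; rewrite -ltr_ln ?posrE ?mulr_gt0 ?powR_gt0//; last by rewrite bgE exprn_gt0.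
  rewrite lnM ?posrE ?powR_gt0//; last by rewrite bgE exprn_gt0.
  rewrite !ln_powR bgE lnXn// kE mulr2n -natr1 => hl; lra.
- move=> x x0; rewrite log_potentialE//.
  (* M >= 1 and M >= gamma give h <= M. As the constant terms of the slope cancel for beta gamma >
     1, its sign is governed by y - r. *)
  have pos (y : R) : 0 < y -> 0 <= ln M + edge_log beta gamma y.
    move=> y0; rewrite -lnM ?posrE//; last by rewrite divr_gt0//; nra.
    apply: ln_ge0; rewrite mulrA ler_pdivlMr; nra.
  have slope (y : R) : 0 < y -> log_potential_slope beta gamma (ln M) y =
      (ln M + edge_log beta gamma y) / (beta * gamma - 1) * gamma * ((y - r) * (y + r) / y).
    move=> y0; rewrite /log_potential_slope absE.
    have -> : (1 - beta * gamma) / (beta * gamma - 1) = -1.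
      by rewrite -opprB mulNr divff//; rewrite gt_eqF//; lra.
    have -> : beta / y = gamma * r ^+ 2 / y by rewrite -bE.
    by field; rewrite !lt0r_neq0//; lra.
  apply: log_potential_min => // y y0.
    move=> yr; rewrite slope//; rewrite mulr_ge0_le0//.
      by rewrite mulr_ge0// divr_ge0 ?pos//; lra.
    by rewrite mulr_le0_ge0 ?invr_ge0 ?(ltW y0)//; nra.
  have y1 : 0 < y by lra.
  rewrite slope// mulr_ge0//; first by rewrite mulr_ge0// divr_ge0 ?pos//; lra.
  by rewrite divr_ge0 ?(ltW y1)//; nra.
Qed.

End FerromagneticPositive.

(** * Positive fields in the antiferromagnetic case *)

Section Antiferromagnetic.
Variable R : realType.
Variables (beta gamma : R).
Hypothesis antiferro : [/\ 0 < beta, 0 <= gamma & beta * gamma < 1].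
Implicit Types (x y : R).

Lemma phiE x : 0 <= x ->
  phi beta gamma x = 2 * (1 - beta * gamma) * x / (beta - gamma * x ^+ 2) - edge_log beta gamma x.
Proof.
have [b0 g0 bg] := antiferro.
move=> x0; have gx := mulr_ge0 g0 x0; congr (_ + _).
have h0 : 0 < (beta + x) / (1 + gamma * x) by rewrite divr_gt0 ?ltr_pwDl.
rewrite /edge_log -lnV ?posrE//.
by rewrite invf_div [gamma * x + 1]addrC [x + beta]addrC.
Qed.

Lemma phi0 : phi beta gamma 0 = - ln beta.
Proof. by rewrite phiE// mulr0 mul0r edge_log0 add0r. Qed.

Lemma edge_log_homo x y : 0 <= x -> x <= y -> edge_log beta gamma x <= edge_log beta gamma y.
Proof.
have [b0 g0 bg] := antiferro.
move=> x0 xy; have y0 : 0 <= y by lra.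
have gx := mulr_ge0 g0 x0; have gy := mulr_ge0 g0 y0.
have bx : 0 < beta + x by rewrite ltr_pwDl.
have by0 : 0 < beta + y by rewrite ltr_pwDl.
have gx1 : 0 < 1 + gamma * x by lra.
have gy1 : 0 < 1 + gamma * y by lra.
rewrite ler_ln ?posrE ?divr_gt0// ler_pdivrMr// mulrAC ler_pdivlMr//.
have : 0 <= (y - x) * (1 - beta * gamma) by rewrite mulr_ge0// subr_ge0// ltW.
lra.
Qed.

(** Between [x] and [y] the rational term of [phi] grows by at least 2 (1 - beta gamma)(y - x) /
    beta, while [edge_log] grows by at most half of that. *)
Lemma phi_lt x y : 0 <= x -> x < y -> gamma * y ^+ 2 < beta ->
  phi beta gamma x < phi beta gamma y.
Proof.
have [b0 g0 bg] := antiferro.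
move=> x0 xy gy2; have y0 : 0 <= y by lra.
have gx := mulr_ge0 g0 x0; have gy := mulr_ge0 g0 y0.
have gx2 : gamma * x ^+ 2 <= gamma * y ^+ 2 by rewrite ler_wpM2l// ler_pXn2r ?nnegrE//; lra.
have gx20 : 0 <= gamma * x ^+ 2 by rewrite mulr_ge0 ?sqr_ge0.
have Dx : 0 < beta - gamma * x ^+ 2 by lra.
have Dy : 0 < beta - gamma * y ^+ 2 by lra.
have bx : 0 < beta + x by lra.
have by0 : 0 < beta + y by lra.
have gx1 : 0 < 1 + gamma * x by lra.
have gy1 : 0 < 1 + gamma * y by lra.
have vxy : edge_log beta gamma y - edge_log beta gamma x <= (1 - beta * gamma) * (y - x) / beta.
  have q0 : 0 < (beta + y) / (1 + gamma * y) / ((beta + x) / (1 + gamma * x)).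
    by rewrite !divr_gt0.
  rewrite /edge_log -ln_div ?posrE ?divr_gt0//.
  apply: le_trans (ln_le_subr1 q0) _.
  have -> : (beta + y) / (1 + gamma * y) / ((beta + x) / (1 + gamma * x)) - 1 =
     (1 - beta * gamma) * (y - x) / ((1 + gamma * y) * (beta + x)).
    by field; rewrite !lt0r_neq0.
  have sxy : 0 <= (1 - beta * gamma) * (y - x).
    by rewrite mulr_ge0//; lra.
  rewrite ler_wpM2l// lef_pV2 ?posrE ?mulr_gt0//.
  have : 0 <= gamma * y * (beta + x) by rewrite mulr_ge0// ltW.
  lra.
rewrite !phiE//.
suff : (y - x) / beta <= y / (beta - gamma * y ^+ 2) - x / (beta - gamma * x ^+ 2).
  move=> h; have s0 : 0 < 1 - beta * gamma by lra.
  have : 2 * (1 - beta * gamma) * ((y - x) / beta) <=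
     2 * (1 - beta * gamma) * (y / (beta - gamma * y ^+ 2) - x / (beta - gamma * x ^+ 2)).
    by rewrite ler_pM2l//; lra.
  have : 0 < (1 - beta * gamma) * (y - x) / beta by rewrite divr_gt0// mulr_gt0//; lra.
  lra.
have -> : y / (beta - gamma * y ^+ 2) - x / (beta - gamma * x ^+ 2) =
  (y - x) * ((beta + gamma * x * y) / ((beta - gamma * y ^+ 2) * (beta - gamma * x ^+ 2))).
  by field; rewrite !lt0r_neq0.
have yx : 0 <= y - x by lra.
rewrite ler_wpM2l// ler_pdivlMr ?mulr_gt0// mulrC ler_pdivrMr//.
have : 0 <= gamma * x * y by rewrite mulr_ge0.
have : (beta - gamma * y ^+ 2) * (beta - gamma * x ^+ 2) <= beta * beta.
  by apply: ler_pM; lra.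
nra.
Qed.

Lemma phi_homo x y : 0 <= x -> x <= y -> gamma * y ^+ 2 < beta ->
  phi beta gamma x <= phi beta gamma y.
Proof. by move=> x0; rewrite le_eqVlt => /predU1P[->//|xy] gy; exact/ltW/phi_lt. Qed.

(** L = phi(xh) makes [xh] the minimiser of the potential. P = L / E(xh) then cancels the
    contribution of L to the minimum, and the degree enters only through d L <= P. *)
Lemma zero_free_near_phi d (lambda0 xh : R) : 0 < xh -> gamma * xh ^+ 2 < beta ->
  0 <= phi beta gamma xh ->
  d%:R * phi beta gamma xh <= phi beta gamma xh / edge_slope beta gamma xh ->
  0 < lambda0 ->
  ln lambda0 < ln xh + edge_log beta gamma xh / edge_slope beta gamma xh ->
  zero_free_near d.+1 beta gamma lambda0.
Proof.
have [b0 g0 bg] := antiferro.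
move=> x0 gx2 L0 dP l0 ll; set L := phi _ _ _ in L0 dP.
have bgn : beta * gamma != 1 by rewrite lt_eqF.
have s0 : 0 < 1 - beta * gamma by lra.
have absE : `|1 - beta * gamma| = 1 - beta * gamma by rewrite gtr0_norm.
have gx := mulr_ge0 g0 (ltW x0).
have LE : L + edge_log beta gamma xh = 2 * (1 - beta * gamma) * xh / (beta - gamma * xh ^+ 2).
  by rewrite /L phiE ?ltW// subrK.
have LE0 : 0 < L + edge_log beta gamma xh by rewrite LE divr_gt0 ?mulr_gt0//; lra.
refine (@zero_free_near_sector _ d beta gamma L (L / edge_slope beta gamma xh) lambda0
  (log_potential beta gamma L xh) _ _ _ _ _ _ _ _ _ _) => //.
- have [->|gn0] := eqVneq gamma 0; first exact: expR_ge0.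
  have gg : 0 < gamma by rewrite lt_def gn0.
  rewrite -[leLHS]lnK ?posrE// ler_expR.
  suff : edge_log beta gamma xh <= - ln gamma by lra.
  rewrite -lnV ?posrE// ler_ln ?posrE ?invr_gt0//; last by rewrite divr_gt0//; lra.
  by rewrite ler_pdivrMr ?ler_pdivlMl//; nra.
- have := @phi_lt 0 xh (lexx _) x0 gx2; rewrite phi0 -/L; lra.
- by rewrite -log_potentialE// [(L + edge_log _ _ _) / _]mulrDl; lra.
- move=> x x0'; rewrite log_potentialE//.
  have slope (y : R) : 0 < y -> log_potential_slope beta gamma L y =
      2 - (L + edge_log beta gamma y) * (beta - gamma * y ^+ 2) / ((1 - beta * gamma) * y).
    move=> y0; rewrite /log_potential_slope absE divff ?lt0r_neq0//.
    by field; rewrite !lt0r_neq0.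
  have phiy (y : R) : 0 < y -> 0 < beta - gamma * y ^+ 2 ->
      L - phi beta gamma y = (L + edge_log beta gamma y) -
         2 * (1 - beta * gamma) * y / (beta - gamma * y ^+ 2).
    by move=> y0 Dy; rewrite phiE ?ltW//; lra.
  apply: log_potential_min => // y y0.
    move=> yx; have gy2 : gamma * y ^+ 2 <= gamma * xh ^+ 2.
      by rewrite ler_wpM2l// ler_pXn2r ?nnegrE//; lra.
    have Dy : 0 < beta - gamma * y ^+ 2 by lra.
    have := phi_homo (ltW y0) yx gx2; rewrite -/L -subr_ge0 phiy// subr_ge0.
    rewrite ler_pdivrMr// slope// subr_le0 ler_pdivlMr ?mulr_gt0//; lra.
  have y1 : 0 < y by lra.
  rewrite slope// subr_ge0 ler_pdivrMr ?mulr_gt0//.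
  have [Dy|Dy] := ltP 0 (beta - gamma * y ^+ 2).
    have Dy' : gamma * y ^+ 2 < beta by lra.
    have := phi_homo (ltW x0) y0 Dy'; rewrite -/L -subr_le0 phiy// subr_le0.
    rewrite ler_pdivlMr//; lra.
  (* Beyond sqrt(beta / gamma) the slope is at least 2, because L - ln h(y) remains positive. *)
  have := edge_log_homo (ltW x0) y0; nra.
Qed.

Lemma edge_slopeV x : 0 < x ->
  (edge_slope beta gamma x)^-1 = (gamma * x + beta / x + 1 + beta * gamma) / (1 - beta * gamma).
Proof.
have [b0 g0 bg] := antiferro.
move=> x0; have gx := mulr_ge0 g0 (ltW x0); have s0 : 0 < 1 - beta * gamma by lra.
rewrite /edge_slope gtr0_norm// invf_div.
by field; rewrite !lt0r_neq0.
Qed.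

Lemma edge_slopeV_le x y : 0 < x -> x <= y -> gamma * y ^+ 2 < beta ->
  (edge_slope beta gamma y)^-1 <= (edge_slope beta gamma x)^-1.
Proof.
have [b0 g0 bg] := antiferro.
move=> x0 xy gy2; have y0 : 0 < y by lra.
have s0 : 0 < 1 - beta * gamma by lra.
rewrite !edge_slopeV// ler_wpM2r ?invr_ge0 ?(ltW s0)// !lerD2r -subr_ge0.
have -> : gamma * x + beta / x - (gamma * y + beta / y) =
    (y - x) * (beta - gamma * x * y) / (x * y) by field; rewrite !lt0r_neq0.
rewrite divr_ge0 ?mulr_ge0 ?(ltW x0) ?(ltW y0) ?subr_ge0//.
have : gamma * x * y <= gamma * y ^+ 2 by rewrite expr2 mulrA ler_wpM2r ?ler_wpM2l ?(ltW y0).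
lra.
Qed.

(** The intermediate value theorem is applied to N = (beta - gamma x^2) phi(x), which stays
    continuous at sqrt(beta / gamma), where it is positive; N(0) = - beta ln beta < 0. For gamma = 0
    the right endpoint is beta ln beta, by ln (1 + u) <= u. *)
Lemma exists_phi_root : 1 < beta ->
  exists x, [/\ 0 < x, gamma * x ^+ 2 < beta & phi beta gamma x = 0].
Proof.
have [b0 g0 bg] := antiferro.
move=> b1; have lb : 0 < ln beta by exact: ln_gt0.
have s0 : 0 < 1 - beta * gamma by lra.
pose N x := 2 * (1 - beta * gamma) * x +
  (beta - gamma * (x * x)) * (ln (1 + gamma * x) - ln (beta + 1 * x)).
have NE x : 0 <= x -> beta - gamma * x ^+ 2 != 0 ->
    N x = (beta - gamma * x ^+ 2) * phi beta gamma x.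
  move=> x0 Dx; have gx := mulr_ge0 g0 x0.
  rewrite phiE// /edge_log ln_div ?posrE; try lra.
  by rewrite /N mul1r; field.
have dN x : 0 <= x -> derivable N x 1.
  move=> x0; have gx := mulr_ge0 g0 x0.
  have d1 : is_derive x 1 (fun y => ln (beta + 1 * y)) (1 / (beta + 1 * x)).
    by apply: is_derive_affine_ln; lra.
  have d2 : is_derive x 1 (fun y => ln (1 + gamma * y)) (gamma / (1 + gamma * x)).
    by apply: is_derive_affine_ln; lra.
  exact: ex_derive.
have [B [B0 NB BE]] : exists B, [/\ 0 < B, 0 <= N B & 0 < gamma -> gamma * B ^+ 2 = beta].
  have [gz|gn0] := eqVneq gamma 0.
    exists (beta * ln beta); rewrite mulr_gt0//; split=> //; last by rewrite gz ltxx.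
    rewrite /N gz mulr0 subr0 !mul0r addr0 ln1 sub0r mul1r mulr1.
    have -> : beta + beta * ln beta = beta * (1 + ln beta) by ring.
    rewrite lnM ?posrE//; last lra.
    have h : ln (1 + ln beta) <= ln beta by apply: le_ln1Dx; lra.
    nra.
  have gg : 0 < gamma by rewrite lt_def gn0.
  have q0 : 0 < beta / gamma by rewrite divr_gt0.
  have BE : gamma * Num.sqrt (beta / gamma) ^+ 2 = beta.
    by rewrite sqr_sqrtr ?ltW// mulrC divfK.
  exists (Num.sqrt (beta / gamma)); split=> //; first by rewrite sqrtr_gt0.
  by rewrite /N -expr2 BE subrr mul0r addr0 !mulr_ge0 ?sqrtr_ge0 ?ltW//; lra.
have N0 : N 0 < 0.
  rewrite /N !mulr0 subr0 add0r !addr0 ln1 sub0r mulrN oppr_lt0 mulr_gt0//.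
have [| |c] := @IVT _ N 0 B 0 (ltW B0).
- apply: continuous_in_subspaceT => x; rewrite inE /= in_itv /= => /andP[x0 _].
  exact/differentiable_continuous/derivable1_diffP/dN.
- by rewrite ge_min (ltW N0) le_max NB orbT.
rewrite in_itv /= => /andP[c0 cB] Nc.
have {c0}c0 : 0 < c.
  rewrite lt_neqAle c0 andbT; apply/eqP => cE.
  by move: N0; rewrite -cE in Nc; rewrite Nc ltxx.
have gc : gamma * c ^+ 2 < beta.
  have [->|gn0] := eqVneq gamma 0; first by rewrite mul0r.
  have gg : 0 < gamma by rewrite lt_def gn0.
  have {cB}cB : c < B.
    rewrite lt_neqAle cB andbT; apply/eqP => cB'.
    move: Nc; rewrite cB' /N -expr2 BE// subrr mul0r addr0; nra.
  by rewrite -[ltRHS](BE gg) ltr_pM2l// ltr_pXn2r ?nnegrE// ltW.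
exists c; split=> //; have Dc : beta - gamma * c ^+ 2 != 0 by rewrite lt0r_neq0// subr_gt0.
move: Nc; rewrite NE ?ltW// => /eqP; rewrite mulf_eq0 (negPf Dc) => /eqP.
exact.
Qed.

Lemma ltr_sqrt_div x : 0 < x ->
  (gamma = 0 \/ x < Num.sqrt (beta / gamma)) <-> gamma * x ^+ 2 < beta.
Proof.
have [b0 g0 bg] := antiferro.
move=> x0; have [->|gn0] := eqVneq gamma 0; first by rewrite mul0r; split=> // _; left.
have gg : 0 < gamma by rewrite lt_def gn0.
have h : (x < Num.sqrt (beta / gamma)) = (gamma * x ^+ 2 < beta).
  rewrite -{1}(ger0_norm (ltW x0)) -sqrtr_sqr ltr_sqrt ?divr_gt0// ltr_pdivlMr// mulrC.
  by rewrite mulrC.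
by split=> [[/eqP|]|]; rewrite ?(negPf gn0)// h//; right.
Qed.

Lemma x_cP : 1 < beta -> [/\ 0 < x_c beta gamma, gamma * x_c beta gamma ^+ 2 < beta
  & phi beta gamma (x_c beta gamma) = 0].
Proof.
have [b0 g0 bg] := antiferro.
move=> b1; have [x [x0 gx px]] := exists_phi_root b1.
have [|y0 gy py] := xgetPex 0 (_ : exists y, [/\ 0 < y,
    gamma = 0 \/ y < Num.sqrt (beta / gamma) & phi beta gamma y = 0]).
  by exists x; split=> //; apply/ltr_sqrt_div.
by split=> //; apply/ltr_sqrt_div.
Qed.

Lemma sqrt_bg_lt1 : Num.sqrt (beta * gamma) < 1.
Proof. by have [b0 g0 bg] := antiferro; rewrite -sqrtr1 ltr_sqrt. Qed.

Lemma sqr_sqrt_bg : Num.sqrt (beta * gamma) ^+ 2 = beta * gamma.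
Proof. have [b0 g0 bg] := antiferro; by rewrite sqr_sqrtr// mulr_ge0// ltW. Qed.

(** The strict inequality of arithmetic and geometric means for gamma x and beta / x, whose product
    is beta gamma. *)
Lemma d_bar_lt x : 0 < x -> gamma * x ^+ 2 < beta ->
  d_bar beta gamma < (edge_slope beta gamma x)^-1.
Proof.
have [b0 g0 bg] := antiferro.
move=> x0 gx2; rewrite edge_slopeV// /d_bar; have s1 := sqrt_bg_lt1; have sE := sqr_sqrt_bg.
have s0 : 0 <= Num.sqrt (beta * gamma) by exact: sqrtr_ge0.
set s := Num.sqrt _ in s1 sE s0 *.
have w0 : 0 < beta / x by exact: divr_gt0.
have wE : beta / x * x = beta by rewrite divfK// lt0r_neq0.
have gx : gamma * x < beta / x by rewrite ltr_pdivlMr// -mulrA -expr2.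
have gx0 : 0 <= gamma * x by rewrite mulr_ge0// ltW.
have gw : gamma * x * (beta / x) = s ^+ 2 by rewrite sE; field; exact: lt0r_neq0.
have h : 2 * s < gamma * x + beta / x.
  rewrite -(@ltr_pXn2r _ 2)// ?nnegrE; [|lra|lra].
  have : 0 < (beta / x - gamma * x) ^+ 2 by rewrite exprn_gt0// subr_gt0.
  by rewrite exprMn sqrrB sqrrD [beta / x * (gamma * x)]mulrC gw; lra.
rewrite -sE (_ : 1 - s ^+ 2 = (1 - s) * (1 + s)); last ring.
rewrite invfM mulrA ltr_pdivlMr; last lra.
by rewrite mulrAC ltr_pM2r ?invr_gt0; nra.
Qed.

Lemma x_hatE x : 0 < x -> gamma * x ^+ 2 < beta ->
  x_hat beta gamma (edge_slope beta gamma x)^-1 = x.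
Proof.
have [b0 g0 bg] := antiferro.
move=> x0 gx2; rewrite edge_slopeV// /x_hat.
have [->|gn0] := eqVneq gamma 0.
  by rewrite mulr0 mul0r subr0 divr1 addr0 add0r addrK invf_div mulrC divfK// lt0r_neq0.
have gg : 0 < gamma by rewrite lt_def gn0.
have gx : gamma * x < beta / x by rewrite ltr_pdivlMr// -mulrA -expr2.
have s0 : 1 - beta * gamma != 0 by rewrite lt0r_neq0//; lra.
set b := -1 - _ + _.
have -> : b = gamma * x + beta / x by rewrite /b divfK//; ring.
have -> : (gamma * x + beta / x) ^+ 2 - 4 * (beta * gamma) = (beta / x - gamma * x) ^+ 2.
  by field; exact: lt0r_neq0.
rewrite sqrtr_sqr gtr0_norm ?subr_gt0//.
by field; rewrite !lt0r_neq0.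
Qed.

(** With [x_hatE], this makes [x_hat] and x |-> 1 / E(x) inverse to each other: x_hat(d) is the
    smaller root of the quadratic equation E(x) = 1 / d. *)
Lemma x_hatP (d : R) : d_bar beta gamma < d ->
  [/\ 0 < x_hat beta gamma d, gamma * x_hat beta gamma d ^+ 2 < beta
    & (edge_slope beta gamma (x_hat beta gamma d))^-1 = d].
Proof.
have [b0 g0 bg] := antiferro.
move=> db; set x := x_hat _ _ _.
have s1 := sqrt_bg_lt1; have sE := sqr_sqrt_bg.
have s0 : 0 <= Num.sqrt (beta * gamma) by exact: sqrtr_ge0.
have bg0 : 0 < 1 - beta * gamma by lra.
have [gz|gn0] := eqVneq gamma 0.
  have d1 : 1 < d by move: db; rewrite /d_bar gz mulr0 sqrtr0 addr0 subr0 divr1.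
  have xE : x = beta / (d - 1) by rewrite /x /x_hat gz eqxx.
  have x0 : 0 < x by rewrite xE divr_gt0//; lra.
  rewrite edge_slopeV// gz mul0r mulr0 mul0r subr0 divr1 addr0 add0r xE invf_div.
  by split=> //; [rewrite -xE|field; rewrite lt0r_neq0].
have gg : 0 < gamma by rewrite lt_def gn0.
pose b := -1 - beta * gamma + d * (1 - beta * gamma).
move: s1 sE s0 db; rewrite /d_bar; move: (Num.sqrt (beta * gamma)) => s s1 sE s0 db.
have hb : 2 * s < b.
  move: db; rewrite ltr_pdivrMr ?subr_gt0// /b -sE => db.
  have : (1 + s) * (1 + s) < d * (1 - s) * (1 + s) by rewrite ltr_pM2r//; lra.
  lra.
have b1 : 0 < b by lra.
have D0 : 0 < b ^+ 2 - 4 * (beta * gamma).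
  rewrite -sE subr_gt0 (_ : 4 * _ = (2 * s) ^+ 2); last ring.
  by rewrite ltr_pXn2r ?nnegrE//; lra.
set r := Num.sqrt (b ^+ 2 - 4 * (beta * gamma)).
have r0 : 0 < r by rewrite sqrtr_gt0.
have rE : r ^+ 2 = b ^+ 2 - 4 * (beta * gamma) by rewrite sqr_sqrtr// ltW.
have rb : r < b.
  rewrite -(@ltr_pXn2r _ 2)// ?nnegrE; [|lra|lra].
  have := mulr_gt0 b0 gg; lra.
have xE : 2 * gamma * x = b - r.
  by rewrite /x /x_hat (negPf gn0) -/b -/r; field.
have x0 : 0 < x.
  have : 0 < 2 * gamma * x by lra.
  by rewrite pmulr_rgt0//; lra.
have quad : gamma * x ^+ 2 - b * x + beta = 0.
  have g4 : 4 * gamma != 0 by rewrite mulf_neq0.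
  apply: (mulfI g4); rewrite mulr0.
  have -> : 4 * gamma * (gamma * x ^+ 2 - b * x + beta) =
     (2 * gamma * x - b) ^+ 2 - (b ^+ 2 - 4 * (beta * gamma)) by ring.
  by rewrite xE -rE; ring.
split=> //.
  have : 0 < x * (b - 2 * gamma * x) by rewrite mulr_gt0//; lra.
  lra.
rewrite edge_slopeV//; apply: (mulIf (lt0r_neq0 bg0)); rewrite divfK ?lt0r_neq0//.
apply: (mulIf (lt0r_neq0 x0)).
have -> : (gamma * x + beta / x + 1 + beta * gamma) * x =
   gamma * x ^+ 2 + beta + (1 + beta * gamma) * x by field; exact: lt0r_neq0.
rewrite /b in quad; lra.
Qed.

Lemma d_cP : 1 < beta -> d_bar beta gamma < d_c beta gamma /\
  x_hat beta gamma (d_c beta gamma) = x_c beta gamma.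
Proof.
have [b0 g0 bg] := antiferro.
move=> b1; have [x0 gx _] := x_cP b1.
apply: (xgetPex 0 (_ : exists d, d_bar beta gamma < d /\ x_hat beta gamma d = x_c beta gamma)).
exists (edge_slope beta gamma (x_c beta gamma))^-1.
by split; [exact: d_bar_lt|exact: x_hatE].
Qed.

Lemma ln_lambda x (d : R) : 0 < x ->
  0 < x * ((x + beta) / (gamma * x + 1)) `^ d /\
  ln (x * ((x + beta) / (gamma * x + 1)) `^ d) = ln x + d * edge_log beta gamma x.
Proof.
have [b0 g0 bg] := antiferro; move=> x0; have gx0 := mulr_ge0 g0 (ltW x0).
have h0 : 0 < (x + beta) / (gamma * x + 1) by rewrite divr_gt0//; lra.
rewrite mulr_gt0 ?powR_gt0// lnM ?posrE ?powR_gt0// ln_powR /edge_log.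
by rewrite [x + _]addrC [_ * x + 1]addrC.
Qed.

Lemma lambda_cE (d : R) : d_bar beta gamma < d -> let x := x_hat beta gamma d in
  exists2 l, lambda_c beta gamma d = l%:E &
    0 < l /\ ln l = ln x + edge_log beta gamma x / edge_slope beta gamma x.
Proof.
have [b0 g0 bg] := antiferro.
move=> db; have [x0 gx dE] := x_hatP db; set x := x_hat _ _ _ in x0 gx dE *.
have gx0 := mulr_ge0 g0 (ltW x0).
have h0 : 0 < (x + beta) / (gamma * x + 1) by rewrite divr_gt0//; lra.
exists (x * ((x + beta) / (gamma * x + 1)) `^ d).
  rewrite /lambda_c -/x; case: ifP => // /andP[/eqP gz /eqP d1].
  by move: db; rewrite d1 /d_bar gz mulr0 sqrtr0 addr0 subr0 divr1 ltxx.
have [l0 ->] := ln_lambda d x0; split=> //; rewrite [in RHS]mulrC.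
by rewrite dE.
Qed.

Lemma exists_phi_ge0 : exists y0, [/\ 0 <= y0, gamma * y0 ^+ 2 < beta,
  y0 = (if 1 < beta then x_c beta gamma else 0) &
  forall x, y0 <= x -> gamma * x ^+ 2 < beta -> 0 <= phi beta gamma x].
Proof.
have [b0 g0 bg] := antiferro.
case: ifPn => [b1|]; last rewrite -leNgt => b1.
  have [x0 gx px] := x_cP b1; exists (x_c beta gamma); split=> //; first exact: ltW.
  by move=> x xx gx2; rewrite -px; apply: phi_homo => //; exact: ltW.
exists 0; split=> //; first by rewrite expr0n mulr0.
move=> x xx gx2; apply: le_trans (phi_homo (lexx 0) xx gx2).
by rewrite phi0 oppr_ge0 ln_le0.
Qed.

(** [D] is meant to be either [d] or the critical value [d_c], where phi = 0 lifts the restriction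
    on the degree. *)
Lemma zero_free_near_x_hat d (D lambda0 : R) : d_bar beta gamma < D ->
  0 <= phi beta gamma (x_hat beta gamma D) ->
  d%:R <= D \/ phi beta gamma (x_hat beta gamma D) = 0 ->
  0 < lambda0 -> (lambda0%:E < lambda_c beta gamma D)%E ->
  zero_free_near d.+1 beta gamma lambda0.
Proof.
move=> db p0 dD l0 ll; have [x0 gx dE] := x_hatP db.
have [l lE [ll0 lnl]] := lambda_cE db.
move: ll; rewrite lE lte_fin -ltr_ln ?posrE// lnl => ll.
apply: (@zero_free_near_phi d lambda0 (x_hat beta gamma D)) => //.
rewrite dE; case: dD => [dD|->]; last by rewrite mul0r mulr0.
by rewrite mulrC ler_wpM2l.
Qed.

(* At the critical degree the optimal point x_hat is the fixed point of
   x |-> beta / (gamma * x), where phi blows up; one moves x_hat slightly to the left. *)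
Lemma zero_free_near_d_bar d (lambda0 : R) : 0 < gamma -> d_bar beta gamma = d%:R ->
  0 < lambda0 -> (lambda0%:E < lambda_c beta gamma d%:R)%E ->
  zero_free_near d.+1 beta gamma lambda0.
Proof.
have [b0 g0 bg] := antiferro; move=> gg dE l0.
have bgn : beta * gamma != 1 by rewrite lt_eqF.
have gn0 : gamma != 0 by rewrite lt0r_neq0.
rewrite /lambda_c (negPf gn0) /= lte_fin => ll.
set x := x_hat _ _ _ in ll.
have s1 := sqrt_bg_lt1; have sE := sqr_sqrt_bg.
have xE : x = Num.sqrt (beta * gamma) / gamma.
  rewrite /x /x_hat (negPf gn0) -dE /d_bar.
  set s := Num.sqrt (beta * gamma) in s1 sE *; rewrite -sE.
  have -> : -1 - s ^+ 2 + (1 + s) / (1 - s) * (1 - s ^+ 2) = 2 * s.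
    by field; rewrite lt0r_neq0//; lra.
  rewrite (_ : (2 * s) ^+ 2 - 4 * s ^+ 2 = 0) ?sqrtr0 ?subr0; last ring.
  by field.
have x0 : 0 < x by rewrite xE divr_gt0// sqrtr_gt0 mulr_gt0.
have gx2 : gamma * x ^+ 2 = beta.
  by rewrite xE expr_div_n sE; field.
have slope : (edge_slope beta gamma x)^-1 = d%:R.
  rewrite edge_slopeV// -dE /d_bar xE.
  have q0 : Num.sqrt (beta * gamma) != 0 by rewrite sqrtr_eq0 -ltNge mulr_gt0.
  have -> : beta / (Num.sqrt (beta * gamma) / gamma) = Num.sqrt (beta * gamma).
    by rewrite invf_div mulrA -{1}sE expr2 mulfK.
  rewrite [gamma * _]mulrC divfK//.
  move: s1 sE (sqrtr_ge0 (beta * gamma)).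
  move: (Num.sqrt (beta * gamma)) => s s1 <- s0.
  have -> : s + s + 1 + s ^+ 2 = (1 + s) * (1 + s) by ring.
  rewrite (_ : 1 - s ^+ 2 = (1 - s) * (1 + s)); last ring.
  have s1' : 0 < 1 + s by rewrite ltr_wpDr.
  by rewrite -mulf_div divff ?mulr1// lt0r_neq0.
have [y0 [y00 gy0 _ py0]] := exists_phi_ge0.
have yx : y0 < x.
  by rewrite -(@ltr_pXn2r _ 2)// ?nnegrE ?ltW// -(ltr_pM2l gg) gx2.
(* For L = 0 the potential is the bound on ln lambda0 in [zero_free_near_phi], so the strict
   inequality persists slightly to the left of [x]. *)
have cont : {for x, continuous (log_potential beta gamma 0)}.
  have := is_derive_log_potential 0 b0 g0 bgn x0.
  by move=> [/derivable1_diffP/differentiable_continuous].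
have lx : ln lambda0 < log_potential beta gamma 0 x.
  have [l0' lnE] := ln_lambda d%:R x0.
  by rewrite -log_potentialE// add0r slope mulrC -lnE ltr_ln ?posrE.
have [z [zy zx lz]] : exists z, [/\ y0 < z, z < x & ln lambda0 < log_potential beta gamma 0 z].
  have hl : \forall z \near at_left x, ln lambda0 < log_potential beta gamma 0 z.
    exact: (cvgr_gt _ (cvg_at_left_filter cont)).
  near (at_left x) => z; exists z; split; near: z => //.
  - exact: nbhs_left_gt.
  - exact: nbhs_left_lt.
have z0 : 0 < z by lra.
have gz2 : gamma * z ^+ 2 < beta.
  by rewrite -gx2 ltr_pM2l// ltr_pXn2r ?nnegrE ?ltW.
have pz : 0 <= phi beta gamma z by apply: py0 => //; exact: ltW.
apply: (@zero_free_near_phi d lambda0 z) => //.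
- by rewrite mulrC ler_wpM2l// -dE; exact/ltW/d_bar_lt.
- by move: lz; rewrite -log_potentialE// add0r.
Unshelve. all: by end_near.
Qed.

(** Here the threshold is infinite: for gamma = 0 any large point is admissible as [xh], 1 / E is
    always at least 1, and the bound exceeds ln xh. *)
Lemma zero_free_near_gamma0 (lambda0 : R) : gamma = 0 -> 0 < lambda0 ->
  zero_free_near 2 beta gamma lambda0.
Proof.
have [b0 g0 bg] := antiferro; move=> gz l0.
have [y0 [y00 gy0 _ py0]] := exists_phi_ge0.
set z := lambda0 + 1 + y0; have z0 : 0 < z by rewrite /z; lra.
have gz2 : gamma * z ^+ 2 < beta by rewrite gz mul0r.
have pz : 0 <= phi beta gamma z by apply: py0 => //; rewrite /z; lra.
have slope : 1 <= (edge_slope beta gamma z)^-1.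
  rewrite edge_slopeV// gz mul0r mulr0 subr0 divr1 addr0 add0r lerDr.
  by rewrite divr_ge0// ltW.
apply: (@zero_free_near_phi 1 lambda0 z) => //.
  by rewrite mulrC ler_wpM2l.
have lz : ln lambda0 < ln z by rewrite ltr_ln ?posrE// /z; lra.
have ez : 0 <= edge_log beta gamma z.
  by rewrite ln_ge0// gz mul0r addr0 divr1 /z; lra.
have : 0 <= edge_log beta gamma z / edge_slope beta gamma z.
  by rewrite mulr_ge0//; lra.
lra.
Qed.

End Antiferromagnetic.

(** * Case analysis for positive antiferromagnetic fields *)

Section Condition3.
Variable R : realType.

Lemma zero_free_near_condition3 Delta (beta gamma lambda0 : R) : (0 < Delta)%N ->
  0 < beta -> 0 <= gamma -> condition3 Delta beta gamma lambda0 ->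
  zero_free_near Delta beta gamma lambda0.
Proof.
case: Delta => // d _ b0 g0 [hs l0].
have d1 : d.+1%:R = d%:R + 1 :> R by rewrite -natr1.
have dn : 0 <= d%:R :> R by exact: ler0n.
set s := Num.sqrt _ in hs.
have s0 : 0 <= s by exact: sqrtr_ge0.
have hs' : s * (d%:R + 1) <= d%:R - 1.
  move: hs; rewrite d1 ler_pdivlMr; lra.
have s1 : s < 1 by nra.
have bg : beta * gamma < 1.
  have sE : s ^+ 2 = beta * gamma by rewrite sqr_sqrtr// mulr_ge0// ltW.
  by rewrite -sE expr_lt1.
have anti : [/\ 0 < beta, 0 <= gamma & beta * gamma < 1] by [].
have dbar : d_bar beta gamma <= d%:R.
  by rewrite /d_bar -/s ler_pdivrMr ?subr_gt0//; lra.
have [y0 [y00 gy0 y0c py0]] := exists_phi_ge0 anti.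
case: ifPn => [/andP[b1 dc]|nb ll].
  have [dcb dcx] := d_cP anti b1.
  have [_ _ pc] := x_cP anti b1.
  by apply: (zero_free_near_x_hat anti dcb) => //; rewrite dcx pc; [|right].
have dE : d.+1%:R - 1 = d%:R :> R by rewrite d1 addrK.
(* At d = d_bar the point x_hat leaves the admissible range: it is infinite if gamma = 0 (then d =
   1), and equals sqrt(beta / gamma) otherwise. *)
rewrite dE in ll; move: dbar; rewrite le_eqVlt => /predU1P[dbE|dbar].
  have [gz|gn0] := eqVneq gamma 0.
    have d1' : d = 1%N.
      apply/eqP; rewrite -(@eqr_nat R) -dbE /d_bar gz mulr0 sqrtr0 addr0 subr0 divr1.
      by rewrite eqxx.
    by rewrite d1'; exact: zero_free_near_gamma0.
  by apply: (zero_free_near_d_bar anti) => //; rewrite lt_def gn0.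
have [x0 gx xE] := x_hatP anti dbar.
apply: (zero_free_near_x_hat anti dbar) => //; last by left.
apply: py0 => //; move: nb; rewrite y0c; case: ifP => [b1 /=|_ _]; last exact: ltW.
rewrite -leNgt d1 lerD2r => ddc.
have [dcb dcx] := d_cP anti b1.
have [cx0 cgx cE] := x_hatP anti dcb.
(* d <= d_c forces x_hat(d) >= x_c, hence phi >= 0: otherwise the monotonicity of 1 / E would give
   d_c <= d, so d = d_c. *)
rewrite leNgt -dcx; apply/negP => xx.
have := edge_slopeV_le anti x0 (ltW xx) cgx; rewrite xE cE => dcd.
have dd : d_c beta gamma = d%:R by apply/eqP; rewrite eq_le dcd.
by move: xx; rewrite dd ltxx.
Qed.

End Condition3.

Theorem theorem1 (R : realType) (Delta : nat) (beta gamma lambda0 : R)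
    (Delta_gt0 : (0 < Delta)%N) (beta_gt0 : 0 < beta) (gamma_ge0 : 0 <= gamma)
    (cond : condition1 Delta beta gamma lambda0 \/
            condition2 Delta beta gamma lambda0 \/
            condition3 Delta beta gamma lambda0 \/
            condition4 Delta beta gamma lambda0) :
  exists delta : R, 0 < delta /\
    forall (lambda : R[i]), segment_nbhd lambda0 delta lambda -> lambda != 0 ->
    forall (V : finType) (e : rel V), simple_graph e -> max_degree_le e Delta ->
    forall (S : {set V}) (tau : V -> bool), feasible beta gamma e S tau ->
      partition_function beta gamma e S tau lambda != 0.
Proof.
case: cond => [c|[c|[c|c]]].
- exact: zero_free_near_condition1 c.
- exact: zero_free_near_condition2 c.
- exact: zero_free_near_condition3 c.
- exact: zero_free_near_condition4 c.
Qed.
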